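(* Let $t\ge1$ be a fixed integer, let $a\ge b\ge0$ be constants, and consider the random annulus graph $\mathrm{RAG}_t(n,[r_1,r_2])$ with $r_1=b\big(\tfrac{\log n}{n}\big)^{1/t}$ and $r_2=a\big(\tfrac{\log n}{n}\big)^{1/t}$. Let $$\psi(t)=\frac{\sqrt{\pi}\,(t+1)\,\Gamma(\frac{t+2}{2})}{\Gamma(\frac{t+3}{2})},$$ where $\Gamma(x)=\int_0^\infty y^{x-1}e^{-y}\,dy$. If $a^t-b^t<\psi(t)$, then with probability $1-o(1)$ the graph has an isolated vertex; if $a^t-b^t>\psi(t)$, then with probability $1-o(1)$ the graph has no isolated vertex.
   Context: Let $S^t=\{x\in\mathbb{R}^{t+1}:\|x\|_2=1\}$. For $0\le r_1\le r_2\le 2$, the random annulus graph $\mathrm{RAG}_t(n,[r_1,r_2])$ has vertex set $\{1,\dots,n\}$; each vertex $i$ receives an independent random vector $X_i$ uniformly distributed on $S^t$, and distinct vertices $i,j$ are adjacent if and only if $r_1\le\|X_i-X_j\|_2\le r_2$. $\log$ is the natural logarithm. *)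

(* Defs.v *)
From HB Require Import structures.
From mathcomp Require Import all_boot all_order all_algebra.
From mathcomp Require Import all_classical all_reals all_analysis.

Set Implicit Arguments.
Unset Strict Implicit.
Unset Printing Implicit Defensive.

Import Order.TTheory GRing.Theory Num.Theory.
Import numFieldNormedType.Exports.

Local Open Scope classical_set_scope.
Local Open Scope ring_scope.

(* The library norm on ['cV[R]_m] is the sup norm, hence this definition; the
   topology, and so the Borel sets below, are the same for both norms. *)
Definition enorm (R : realType) (m : nat) (x : 'cV[R]_m) : R :=
  Num.sqrt (\sum_(k < m) x k ord0 ^+ 2).

Definition sphere (R : realType) (t : nat) : set 'cV[R]_t.+1 :=
  [set x | enorm x = 1].

Definition borel (R : realType) (m : nat) : set (set 'cV[R]_m) :=
  <<s [set U : set 'cV[R]_m | open U] >>.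

Definition random_vector (R : realType) (d : measure_display)
    (Om : measurableType d) (m : nat) (X : Om -> 'cV[R]_m) : Prop :=
  forall A, borel A -> measurable (X @^-1` A).

(* The uniform distribution on the sphere is the (unique) probability law that
   is carried by the sphere and invariant under the orthogonal group. *)
Definition uniform_on_sphere (R : realType) (d : measure_display)
    (Om : measurableType d) (P : probability Om R) (t : nat)
    (X : Om -> 'cV[R]_t.+1) : Prop :=
  P (X @^-1` @sphere R t) = 1%E /\
  forall Q : 'M[R]_t.+1, Q *m Q^T = 1%:M ->
  forall A, borel A -> P [set w | A (Q *m X w)] = P [set w | A (X w)].

Definition mutually_independent (R : realType) (d : measure_display)
    (Om : measurableType d) (P : probability Om R) (n m : nat)
    (X : 'I_n -> Om -> 'cV[R]_m) : Prop :=
  forall (J : {set 'I_n}) (A : 'I_n -> set 'cV[R]_m),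
    (forall i, borel (A i)) ->
    P (\bigcap_(i in [set` J]) (X i @^-1` A i)) =
    (\prod_(i in J) P (X i @^-1` A i))%E.

Definition iid_uniform_on_sphere (R : realType) (d : measure_display)
    (Om : measurableType d) (P : probability Om R) (n t : nat)
    (X : 'I_n -> Om -> 'cV[R]_t.+1) : Prop :=
  [/\ forall i, random_vector (X i),
      forall i, uniform_on_sphere P (X i) &
      mutually_independent P X].

Definition rag (R : realType) (n m : nat) (r1 r2 : R)
    (x : 'I_n -> 'cV[R]_m) : rel 'I_n :=
  fun i j => (i != j) && (r1 <= enorm (x i - x j) <= r2).

Definition has_isolated (n : nat) (e : rel 'I_n) : bool :=
  [exists i, [forall j, ~~ e i j]].

Definition Gamma (R : realType) (x : R) : R :=
  \int[@lebesgue_measure R]_(y in `]0, +oo[) (y `^ (x - 1) * expR (- y)).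

Definition psi (R : realType) (t : nat) : R :=
  Num.sqrt pi * (t%:R + 1) * Gamma ((t%:R + 2) / 2) / Gamma ((t%:R + 3) / 2).

Definition scaled_radius (R : realType) (t : nat) (c : R) (n : nat) : R :=
  c * (ln n%:R / n%:R) `^ (t%:R^-1).

(* Main.v *)
(* Fix a vertex at [x] on the sphere.  Rotation invariance makes the probability
   [p] that another vertex is adjacent to it independent of [x], so that a vertex
   is isolated with probability [(1 - p) ^ (n - 1)].  If [n p / log n] tends to a
   limit [k], the expected number of isolated vertices is [n ^ (1 - k + o(1))]:
   for [k > 1] the union bound shows that with high probability there is none, and
   for [k < 1] Chebyshev's inequality shows that there is one, since two vertices at distance
   more than [2 r_2] have disjoint annuli and the closer pairs are too rare to
   contribute to the second moment.

   The constant [k = (a ^ t - b ^ t) / psi t] comes from the measure of small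
   caps.  Let [U] be a coordinate of a uniform point.  The moment
   [E <u, X> ^ (2 k) = |u| ^ (2 k) E U ^ (2 k)], expanded at [u = e_0 + e e_i] to
   second order in [e] and summed over [i], gives
   [t E U ^ (2 k) = (2 k - 1) (E U ^ (2 k - 2) - E U ^ (2 k))], the recursion
   satisfied by the integrals of [cos ^ (2 k) sin ^ (t - 1)] over [0, pi / 2].  So
   [E q(U ^ 2)] is the average of [q(cos ^ 2)] for the weight [sin ^ (t - 1)], for
   every polynomial [q], and explicit polynomials close to an indicator function
   yield the cap measure [~ r ^ t / (2 t W)] with [W] the Wallis integral of
   [sin ^ (t - 1)]; finally [psi t = 2 t W]. *)

Require Import Defs.
From HB Require Import structures.
From mathcomp Require Import all_boot all_order all_algebra.
From mathcomp Require Import all_classical all_reals all_analysis.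
From mathcomp Require Import measurable_realfun ring lra.
Import Order.TTheory GRing.Theory Num.Theory.
Import numFieldNormedType.Exports.
Local Open Scope classical_set_scope.
Local Open Scope ring_scope.
Set Implicit Arguments.
Unset Strict Implicit.
Unset Printing Implicit Defensive.

(** * Wallis integrals *)

(** Throughout, [t = s + 1]. The law of a vertex is known only through its rotation invariance, so
    there is neither a density nor spherical coordinates to start from; moments are what invariance
    gives directly. Even moments suffice: by the symmetry [x -> - x], a cap has half the measure of
    a set described by [U ^ 2]. A relative error [O(r ^ 2)] on caps disappears as [r -> 0], so the
    angular integral is only squeezed, by means of [sin ^ s * cos], which has a primitive.
    Independence too comes in a bare form, as a product rule for finitely many preimages. Fixing a
    vertex therefore goes through Fubini on a sigma-algebra generated by rectangles, and each event
    has to be shown to belong to it. In the second moment a pair within [2 * r_2] costs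
    [(1 - p) ^ (n - 2) * q] with [q = O(log n / n)], to be compared with [(1 - p) ^ (2 n - 2)]. The
    quotient is of order [log n / (n (1 - p) ^ n)], and [n (1 - p) ^ n] is at least a positive power
    of [n] when [k < 1]: in this sense close pairs are too rare. All errors are bounded by a
    constant over [log n]. *)

Section trig_integrals.
Context {R : realType}.
Local Notation mu := (@lebesgue_measure R).

Lemma integrable_itvcc (f : R -> R) (a b : R) : continuous f ->
  mu.-integrable `[a, b] (EFin \o f).
Proof.
move=> cf; apply: continuous_compact_integrable; first exact: segment_compact.
exact: continuous_subspaceT.
Qed.

Lemma RintegralF (F f : R -> R) (a b : R) : a <= b ->
    (forall x : R, is_derive x 1 F (f x)) -> continuous f ->
  \int[mu]_(x in `[a, b]) f x = F b - F a.
Proof.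
rewrite le_eqVlt => /predU1P[<- _ _|ab dF cf].
  by rewrite set_itv1 Rintegral_set1 subrr.
have cF : continuous F.
  by move=> x; apply/differentiable_continuous/derivable1_diffP.
rewrite /Rintegral (@continuous_FTC2 _ f F)//.
- exact: continuous_subspaceT.
- split=> //; first by apply: cvg_at_right_filter; exact: cF.
  by apply: cvg_at_left_filter; exact: cF.
- by move=> x _; rewrite derive1E derive_val.
Qed.

Lemma is_derive_powS (f : R -> R) (x df : R) n : is_derive x 1 f df ->
  is_derive x 1 (fun y => f y ^+ n.+1) (n.+1%:R * f x ^+ n * df).
Proof.
move=> fdf; rewrite (_ : (fun y => _) = f ^+ n.+1); last first.
  by apply/funext => y; rewrite exprfctE.
exact: is_deriveX.
Qed.

Lemma is_derive_mul (f g : R -> R) (x df dg : R) :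
  is_derive x 1 f df -> is_derive x 1 g dg ->
  is_derive x 1 (fun y => f y * g y) (f x * dg + g x * df).
Proof. by move=> fdf gdg; apply: is_deriveM. Qed.

(** The even moments of a coordinate will be quotients of these integrals, with [q = s] and
    [p = 2k]; the case [p = 0] is the Wallis integral [W]. *)
Definition cossin_int (p q : nat) : R :=
  \int[mu]_(x in `[0, pi / 2]) (cos x ^+ p * sin x ^+ q).

Lemma continuous_cossin (p q : nat) : continuous (fun x : R => cos x ^+ p * sin x ^+ q).
Proof.
move=> x; apply: cvgM.
- apply: (@continuous_comp _ _ _ cos (fun y => y ^+ p)); first exact: continuous_cos.
  exact: exprn_continuous.
- apply: (@continuous_comp _ _ _ sin (fun y => y ^+ q)); first exact: continuous_sin.
  exact: exprn_continuous.
Qed.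

Lemma cossin_intS p q :
  cossin_int p q.+2 = cossin_int p q - cossin_int p.+2 q.
Proof.
rewrite /cossin_int -RintegralB//.
- apply: eq_Rintegral => x _; rewrite -addn2 exprD sin2cos2 -(addn2 p) exprD.
  by ring.
- exact/integrable_itvcc/continuous_cossin.
- exact/integrable_itvcc/continuous_cossin.
Qed.

(** The function [cos ^ (p + 1) * sin ^ (q + 1)] vanishes at both ends of the interval, so the
    integral of its derivative is zero. *)
Lemma cossin_int_parts p q :
  q.+1%:R * cossin_int p.+2 q = p.+1%:R * cossin_int p q.+2.
Proof.
have pi20 : 0 <= pi / 2 :> R by rewrite divr_ge0// pi_ge0.
pose F (x : R) : R := cos x ^+ p.+1 * sin x ^+ q.+1.
pose f (x : R) : R := q.+1%:R * (cos x ^+ p.+2 * sin x ^+ q) -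
                p.+1%:R * (cos x ^+ p * sin x ^+ q.+2).
have dF (x : R) : is_derive x 1 F (f x).
  have := is_derive_mul (is_derive_powS p (is_derive_cos x)) (is_derive_powS q (is_derive_sin x)).
  congr (is_derive _ _ _ _); rewrite /f; set c := cos x; set s := sin x; rewrite !exprS; ring.
have cf : continuous f.
  move=> x; apply: cvgB; (apply: cvgM; [exact: cvg_cst|exact: continuous_cossin]).
have := RintegralF pi20 dF cf.
rewrite /F cos_pihalf sin0 !expr0n/= mul0r mulr0 subrr /f RintegralB//.
- rewrite !RintegralZl//; first by move/eqP; rewrite subr_eq0 => /eqP.
  + exact/integrable_itvcc/continuous_cossin.
  + exact/integrable_itvcc/continuous_cossin.
- by apply: integrable_itvcc => x; apply: cvgM; [exact: cvg_cst|exact: continuous_cossin].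
- by apply: integrable_itvcc => x; apply: cvgM; [exact: cvg_cst|exact: continuous_cossin].
Qed.

End trig_integrals.

(** * The Gamma function at half-integers *)

Section gamma.
Context {R : realType}.
Local Notation mu := (@lebesgue_measure R).

(** This is half of [Gamma ((m + 1) / 2)]. The absolute value changes nothing on the domain, but
    makes the integrand nonnegative on the whole line, as monotone convergence over [[0, n]] asks
    for. *)
Definition gauss_mom (m : nat) : \bar R :=
  (\int[mu]_(x in `[0%R, +oo[) (`|x| ^+ m * gauss_fun x)%:E)%E.

Lemma continuous_absX_gauss m : continuous (fun x : R => `|x| ^+ m * gauss_fun x).
Proof.
move=> x; apply: cvgM; last exact: continuous_gauss_fun.
apply: (@continuous_comp R R R (fun y => `|y|) (fun y => y ^+ m)); last exact: exprn_continuous.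
exact: norm_continuous.
Qed.

Lemma continuousX_gauss m : continuous (fun x : R => x ^+ m * gauss_fun x).
Proof.
move=> x; apply: cvgM; last exact: continuous_gauss_fun.
exact: exprn_continuous.
Qed.

Lemma is_derive_gauss (x : R) : is_derive x 1 gauss_fun (- 2 * x * gauss_fun x).
Proof.
have dN : is_derive x 1 (fun y : R => - y ^+ 2) (- 2 * x).
  have := is_deriveN (is_derive_powS 1 (is_derive_id x 1)).
  by congr (is_derive _ _ _ _); rewrite expr1 mulr1 mulNr.
have := @is_derive1_comp R expR (fun y => - y ^+ 2) x _ _ (is_derive_expR _) dN.
by congr (is_derive _ _ _ _); rewrite mulrC.
Qed.

Lemma gauss_mom_cvg m :
  (\int[mu]_(x in `[0%R, n%:R]) (x ^+ m * gauss_fun x)%:E)%E @[n --> \oo]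
    --> gauss_mom m.
Proof.
have := @ge0_cvgn_integral R mu (fun x : R => `|x| ^+ m * gauss_fun x).
rewrite (_ : (fun n : nat => _) =
  (fun n => (\int[mu]_(x in `[0%R, n%:R]) (x ^+ m * gauss_fun x)%:E)%E)).
  apply.
  - by move=> x; rewrite mulr_ge0 ?exprn_ge0 ?gauss_fun_ge0.
  - by apply: continuous_measurable_fun; exact: continuous_absX_gauss.
apply/funext => n; apply: eq_integral => x; rewrite inE/= in_itv/= => /andP[x0 _].
by rewrite ger0_norm.
Qed.

(** The exponential of [n ^ 2] dominates the term of degree [m + 1] of its series, so the sequence
    is at most [(m + 1)! / n] for [n >= 1]. *)
Lemma XgaussS_cvg0 m : (n%:R ^+ m.+1 * gauss_fun n%:R : R) @[n --> \oo] --> (0 : R).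
Proof.
have cvgV : ((m.+1)`!%:R * n%:R^-1 : R) @[n --> \oo] --> (0 : R).
  rewrite -[X in _ --> X](mulr0 ((m.+1)`!%:R)); apply: cvgM; first exact: cvg_cst.
  apply/gtr0_cvgV0; last exact: cvgr_idn.
  by exists 1%N => // n /= n0; rewrite ltr0n.
apply: (@squeeze_cvgr _ _ _ _ (cst 0) (fun n => (m.+1)`!%:R * n%:R^-1)); last 2 first.
- exact: cvg_cst.
- exact: cvgV.
exists 1%N => // n /= n0.
have n1 : 1 <= n%:R :> R by rewrite ler1n.
rewrite mulr_ge0 ?exprn_ge0 ?gauss_fun_ge0//=.
rewrite /gauss_fun expRN ler_pdivrMr ?expR_gt0//.
rewrite mulrAC ler_pdivlMr ?(lt_le_trans ltr01)//.
have := @expR_ge1Dxn R (n%:R ^+ 2) m (sqr_ge0 _).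
set f := (m.+1)`!%:R; have f0 : 0 < f :> R by rewrite ltr0n fact_gt0.
move=> H; apply: (@le_trans _ _ (f * (n%:R ^+ 2 ^+ m.+1 / f))); last first.
  by rewrite ler_pM2l//; apply: le_trans H; rewrite lerDr.
rewrite mulrCA divff ?gt_eqF// mulr1 -exprM -exprSr ler_weXn2l//.
by rewrite mulnC muln2 -addnn addnS ltnS addSn leq_addr.
Qed.

(** Integration by parts on [[0, n]]; the boundary term vanishes in the limit. Finiteness of the new
    moment is part of the conclusion, and comes from the limit of the real-valued truncated
    integrals. *)
Lemma gauss_momSS m (L : R) : gauss_mom m = L%:E ->
  gauss_mom m.+2 = (m.+1%:R / 2 * L)%:E.
Proof.
move=> HL.
pose A k n : R := \int[mu]_(x in `[0, n%:R]) (x ^+ k * gauss_fun x).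
have AE k n : (\int[mu]_(x in `[0%R, n%:R]) (x ^+ k * gauss_fun x)%:E)%E = (A k n)%:E.
  by rewrite fineK// integrable_fin_num//; exact/integrable_itvcc/continuousX_gauss.
have cA : A m n @[n --> \oo] --> L.
  have := @gauss_mom_cvg m; rewrite HL; under eq_fun do rewrite AE.
  by move=> /fine_cvgP[_].
have dF (x : R) : is_derive x 1 (fun y => y ^+ m.+1 * gauss_fun y)
    (m.+1%:R * (x ^+ m * gauss_fun x) - 2 * (x ^+ m.+2 * gauss_fun x)).
  have := is_derive_mul (is_derive_powS m (is_derive_id x 1)) (is_derive_gauss x).
  by congr (is_derive _ _ _ _); rewrite !exprS; ring.
have recA n : A m.+2 n = m.+1%:R / 2 * A m n - n%:R ^+ m.+1 * gauss_fun n%:R / 2.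
  have cf : continuous (fun x : R => m.+1%:R * (x ^+ m * gauss_fun x) - 2 * (x ^+ m.+2 * gauss_fun x)).
    move=> x; apply: cvgB; (apply: cvgM; [exact: cvg_cst|exact: continuousX_gauss]).
  have := RintegralF (ler0n R n) dF cf.
  rewrite RintegralB//; last 2 first.
    apply: integrable_itvcc => x; apply: cvgM; [exact: cvg_cst|exact: continuousX_gauss].
    apply: integrable_itvcc => x; apply: cvgM; [exact: cvg_cst|exact: continuousX_gauss].
  rewrite !RintegralZl//; last 2 first.
    exact/integrable_itvcc/continuousX_gauss.
    exact/integrable_itvcc/continuousX_gauss.
  rewrite expr0n/= mul0r subr0 -/(A m n) -/(A m.+2 n); set T := n%:R ^+ _ * _ => H.
  lra.
have cA2 : A m.+2 n @[n --> \oo] --> m.+1%:R / 2 * L.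
  rewrite (_ : A m.+2 = fun n => m.+1%:R / 2 * A m n - n%:R ^+ m.+1 * gauss_fun n%:R / 2); last first.
    by apply/funext => n; exact: recA.
  rewrite (_ : _ * L = m.+1%:R / 2 * L - 0 / 2); last by rewrite mul0r subr0.
  apply: cvgB; first by apply: cvgM => //; exact: cvg_cst.
  by apply: cvgM; [exact: XgaussS_cvg0|exact: cvg_cst].
have := @gauss_mom_cvg m.+2; under eq_fun do rewrite AE.
move=> /cvg_lim <- //; apply/cvg_lim => //; apply: cvg_EFin => //.
exact: nearW.
Qed.

Lemma gauss_mom0 : gauss_mom 0 = (Num.sqrt pi / 2)%:E.
Proof.
by rewrite -integral0y_gauss; apply: eq_integral => x _; rewrite expr0 mul1r.
Qed.

Lemma gauss_mom1 : gauss_mom 1 = (2^-1)%:E.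
Proof.
have dF (x : R) : is_derive x 1 (fun y => - gauss_fun y / 2) (x * gauss_fun x).
  have := is_derive_mul (is_deriveN (is_derive_gauss x)) (is_derive_cst (2^-1 : R) x 1).
  by congr (is_derive _ _ _ _); rewrite mulr0 add0r/=; field.
have cF : continuous (fun y : R => - gauss_fun y / 2).
  by move=> x; apply/differentiable_continuous/derivable1_diffP.
have e : gauss_mom 1 = (\int[mu]_(x in `[0%R, +oo[) (x * gauss_fun x)%:E)%E.
  apply: eq_integral => x; rewrite inE/= in_itv/= andbT => x0.
  by rewrite expr1 ger0_norm.
rewrite e (@ge0_continuous_FTC2y R _ (fun y => - gauss_fun y / 2) _ 0).
- rewrite /gauss_fun expr0n/= oppr0 expR0 -EFinB; congr EFin; by field.
- by move=> x x0; rewrite mulr_ge0 ?gauss_fun_ge0.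
- apply: continuous_subspaceT => x; apply: cvgM; first exact: cvg_id.
  exact: continuous_gauss_fun.
- rewrite -(mul0r (2^-1)) -oppr0; apply: cvgM; last exact: cvg_cst.
  by apply: cvgN; exact: cvg_gauss_fun.
- by [].
- by apply: cvg_at_right_filter; exact: cF.
- by move=> x _; rewrite derive1E derive_val.
Qed.

(** Substitution [y = x ^ 2], carried out on bounded intervals before passing to the limit. *)
Lemma Gamma_gauss (m : nat) (g : R) : gauss_mom m.+1 = g%:E ->
  Gamma ((m%:R + 2) / 2 : R) = 2 * g.
Proof.
move=> Hg.
(* Written with the square root, [y ^ (m / 2)] is continuous at [0] too, so that the interval can be
   closed there. *)
pose G (y : R) : R := Num.sqrt y ^+ m * expR (- y).
have cG : continuous G.
  move=> x; apply: cvgM.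
    apply: (@continuous_comp R R R Num.sqrt (fun y => y ^+ m)).
      exact: sqrt_continuous.
    exact: exprn_continuous.
  apply: (@continuous_comp R R R -%R expR); last exact: continuous_expR.
  exact: continuousN.
have G0 y : 0 <= G y by rewrite mulr_ge0 ?exprn_ge0 ?sqrtr_ge0 ?expR_ge0.
pose F (x : R) : R := x ^+ 2.
have dF (x : R) : is_derive x 1 F (2 * x).
  have := is_derive_powS 1 (is_derive_id x 1).
  by congr (is_derive _ _ _ _); rewrite expr1 mulr1.
have F'E : F^`()%classic = fun x => 2 * x.
  by apply/funext => x; rewrite derive1E derive_val.
have cF : continuous F.
  by move=> x; apply/differentiable_continuous/derivable1_diffP.
have cF' : continuous F^`()%classic.
  by rewrite F'E => x; apply: cvgM; [exact: cvg_cst|exact: cvg_id].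
rewrite /Gamma /Rintegral.
have -> : (\int[mu]_(y in `]0%R, +oo[) (y `^ ((m%:R + 2) / 2 - 1) * expR (- y))%:E =
           \int[mu]_(y in `[0%R, +oo[) (G y)%:E)%E.
  rewrite -(@integral_itv_obnd_cbnd R 0 _ (EFin \o G)); last first.
    apply/measurable_EFinP/measurable_funTS.
    exact: continuous_measurable_fun.
  apply: eq_integral => y; rewrite inE/= in_itv/= andbT => y0.
  rewrite /G -powR12_sqrt ?ltW// -powR_mulrn ?powR_ge0// -powRrM.
  by congr (_ `^ _ * _)%:E; field.
have c1 := @ge0_cvgn_integral R mu G G0 (continuous_measurable_fun cG).
(* The substitution maps [[0, n]] onto [[0, n ^ 2]], hence a limit along the squares. *)
have c2 : (\int[mu]_(x in `[0%R, (n ^ 2)%N%:R]) (G x)%:E)%E @[n --> \oo] -->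
    (\int[mu]_(x in `[0%R, +oo[) (G x)%:E)%E.
  apply: (@cvg_comp _ _ _ (fun n => (n ^ 2)%N)
    (fun n : nat => (\int[mu]_(x in `[0%R, n%:R]) (G x)%:E)%E) _ _ _ _ c1).
  move=> A [N _ NA]; exists N => // n /= Nn; apply: NA => /=.
  by apply: (leq_trans Nn); case: n {Nn} => // n; rewrite -mulnn leq_pmull.
have E n : (\int[mu]_(x in `[0%R, (n ^ 2)%N%:R]) (G x)%:E =
   2%:E * \int[mu]_(x in `[0%R, n%:R]) (x ^+ m.+1 * gauss_fun x)%:E)%E.
  have := @integration_by_substitution_increasing R F G 0 n%:R (ler0n _ _).
  have -> : F 0 = 0 by rewrite /F expr0n.
  have -> : F n%:R = (n ^ 2)%N%:R by rewrite /F natrX.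
  move=> ->.
  - rewrite -integralZl//; last exact/integrable_itvcc/continuousX_gauss.
    apply: eq_integral => x; rewrite inE/= in_itv/= => /andP[x0 _].
    rewrite F'E -EFinM; congr EFin.
    transitivity (Num.sqrt (x ^+ 2) ^+ m * expR (- x ^+ 2) * (2 * x)) => //.
    by rewrite sqrtr_sqr ger0_norm// /gauss_fun (exprS x m); ring.
  - move=> x y; rewrite !in_itv/= => /andP[x0 _] /andP[y0 _] xy.
    by rewrite /F ltrXn2r.
  - by move=> x _; exact: cF'.
  - apply/cvg_ex; exists (F^`()%classic 0).
    by apply: cvg_at_right_filter; exact: cF'.
  - apply/cvg_ex; exists (F^`()%classic n%:R).
    by apply: cvg_at_left_filter; exact: cF'.
  - split=> //; first by apply: cvg_at_right_filter; exact: cF.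
    by apply: cvg_at_left_filter; exact: cF.
  - exact: continuous_subspaceT.
have c3 : (\int[mu]_(x in `[0%R, (n ^ 2)%N%:R]) (G x)%:E)%E @[n --> \oo] --> (2%:E * g%:E)%E.
  under eq_fun do rewrite E.
  apply: cvgeZl => //; rewrite -Hg; exact: gauss_mom_cvg.
by rewrite (cvg_unique _ c2 c3).
Qed.

Let pi20 : 0 <= pi / 2 :> R.
Proof. by rewrite divr_ge0// pi_ge0. Qed.

Lemma cossin_int00 : @cossin_int R 0 0 = pi / 2.
Proof.
rewrite /cossin_int; under eq_Rintegral do rewrite mulr1.
rewrite (@RintegralF R id (cst 1))// ?subr0//.
by move=> x; exact: cvg_cst.
Qed.

Lemma cossin_int01 : @cossin_int R 0 1 = 1.
Proof.
rewrite /cossin_int; under eq_Rintegral do rewrite mul1r expr1.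
have dF (x : R) : is_derive x 1 (fun x => - cos x) (sin x).
  by have := is_deriveN (is_derive_cos x); rewrite opprK.
rewrite (RintegralF pi20 dF); last exact: continuous_sin.
by rewrite cos_pihalf cos0 oppr0 sub0r opprK.
Qed.

Lemma cossin_int0SS p :
  p.+2%:R * @cossin_int R 0 p.+2 = p.+1%:R * @cossin_int R 0 p.
Proof.
have := @cossin_int_parts R 0 p; have := @cossin_intS R 0 p.
by move=> ->; rewrite -[p.+2%:R]natr1; lra.
Qed.

Lemma cossin_int0_gt0 p : 0 < @cossin_int R 0 p.
Proof.
elim/ltn_ind: p => -[|[|p]] IH.
- by rewrite cossin_int00 divr_gt0// pi_gt0.
- by rewrite cossin_int01.
- rewrite -(@pmulr_rgt0 _ p.+2%:R)//.
  by rewrite cossin_int0SS mulr_gt0// IH.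
Qed.

(** Both sides obey a recursion of step two: [Gamma (x + 1) = x Gamma x], in the form of
    [gauss_momSS], on the left and the Wallis recursion on the right. Two base cases are therefore
    checked. *)
Lemma psi_cossin_int (t : nat) : psi R t.+1 = 2 * t.+1%:R * @cossin_int R 0 t.
Proof.
(* The induction carries the finite values of the two Gaussian moments together with the identity,
   denominators cleared. *)
suff H : exists g1 g2 : R, [/\ gauss_mom t.+2 = g1%:E, gauss_mom t.+3 = g2%:E,
    0 < g1, 0 < g2 & Num.sqrt pi * t.+2%:R * g1 = 2 * t.+1%:R * @cossin_int R 0 t * g2].
  case: H => g1 [g2 [H1 H2 g10 g20 H]].
  rewrite /psi (Gamma_gauss H1) (_ : t.+1%:R + 3 = t.+2%:R + 2); last first.
    by rewrite -[t.+2%:R]natr1; ring.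
  rewrite (Gamma_gauss H2) natr1; apply: (canLR (mulfK _)).
    by rewrite mulf_neq0 ?gt_eqF.
  transitivity (2 * (Num.sqrt pi * t.+2%:R * g1)); first by ring.
  by rewrite H; ring.
have sp0 : 0 < Num.sqrt pi :> R by rewrite sqrtr_gt0 pi_gt0.
have sp2 : Num.sqrt pi * Num.sqrt pi = pi :> R by rewrite -expr2 sqr_sqrtr// pi_ge0.
elim/ltn_ind: t => -[|[|t]] IH.
- have h2 := gauss_momSS gauss_mom0; have h3 := gauss_momSS gauss_mom1.
  exists (1 / 2 * (Num.sqrt pi / 2)), (2 / 2 * 2^-1); split => //; rewrite ?cossin_int00.
  + by lra.
  + by nra.
- have h2 := gauss_momSS gauss_mom1; have h3 := gauss_momSS (gauss_momSS gauss_mom0).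
  exists (2 / 2 * 2^-1), (3 / 2 * (1 / 2 * (Num.sqrt pi / 2))); split => //; rewrite ?cossin_int01.
  + by lra.
  + by nra.
have [//|g1 [g2 [H1 H2 g10 g20 H]]] := IH t.
exists (t.+3%:R / 2 * g1), (t.+4%:R / 2 * g2); split.
- exact: gauss_momSS.
- exact: gauss_momSS.
- by rewrite mulr_gt0 ?divr_gt0.
- by rewrite mulr_gt0 ?divr_gt0.
have := cossin_int0SS t.
have -> : t.+4%:R = t%:R + 4 :> R by rewrite -addn4 natrD.
have -> : t.+3%:R = t%:R + 3 :> R by rewrite -addn3 natrD.
move: H.
have -> : t.+2%:R = t%:R + 2 :> R by rewrite -addn2 natrD.
have -> : t.+1%:R = t%:R + 1 :> R by rewrite -addn1 natrD.
set T := t%:R; have T0 : 0 <= T :> R by rewrite ler0n.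
set s := Num.sqrt pi; set w := @cossin_int R 0 t; set w2 := @cossin_int R 0 t.+2 => H Hw.
have T2 : T + 2 != 0 by rewrite gt_eqF// ltr_wpDl.
apply: (mulfI T2).
transitivity ((T + 4) * (T + 3) / 2 * (s * (T + 2) * g1)); first by field.
rewrite H.
transitivity ((T + 4) * (T + 3) * g2 * ((T + 2) * w2)); last by field.
rewrite Hw; by field.
Qed.

End gamma.

(** * Euclidean and Borel structure of column vectors *)

Section euclid.
Context {R : realType}.
Implicit Types m : nat.

Definition dotv m (x y : 'cV[R]_m) : R := \sum_(k < m) x k ord0 * y k ord0.

Lemma dotvE m (x y : 'cV[R]_m) : x^T *m y = (dotv x y)%:M.
Proof.
rewrite [LHS]mx11_scalar mxE; congr (_%:M).
by apply: eq_bigr => k _; rewrite mxE.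
Qed.

Lemma dotvC m (x y : 'cV[R]_m) : dotv x y = dotv y x.
Proof. by apply: eq_bigr => k _; rewrite mulrC. Qed.

Lemma dotvDl m (x y z : 'cV[R]_m) : dotv (x + y) z = dotv x z + dotv y z.
Proof. by rewrite -big_split; apply: eq_bigr => k _; rewrite mxE mulrDl. Qed.

Lemma dotvZl m (a : R) (x z : 'cV[R]_m) : dotv (a *: x) z = a * dotv x z.
Proof. by rewrite mulr_sumr; apply: eq_bigr => k _; rewrite mxE mulrA. Qed.

Lemma dotvNl m (x z : 'cV[R]_m) : dotv (- x) z = - dotv x z.
Proof. by rewrite -scaleN1r dotvZl mulN1r. Qed.

Lemma dotvBB m (x y : 'cV[R]_m) :
  dotv (x - y) (x - y) = dotv x x - 2 * dotv x y + dotv y y.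
Proof.
rewrite dotvDl dotvNl !(dotvC _ (x - y)) !dotvDl !dotvNl (dotvC y x); ring.
Qed.

Lemma dotv_ge0 m (x : 'cV[R]_m) : 0 <= dotv x x.
Proof. by apply: sumr_ge0 => k _; rewrite -expr2 sqr_ge0. Qed.

Lemma enormE m (x : 'cV[R]_m) : enorm x = Num.sqrt (dotv x x).
Proof. by congr Num.sqrt; apply: eq_bigr => k _; rewrite expr2. Qed.

Lemma enorm_ge0 m (x : 'cV[R]_m) : 0 <= enorm x.
Proof. by rewrite enormE sqrtr_ge0. Qed.

Lemma sqr_enorm m (x : 'cV[R]_m) : enorm x ^+ 2 = dotv x x.
Proof. by rewrite enormE sqr_sqrtr// dotv_ge0. Qed.

Lemma enorm_distC m (x y : 'cV[R]_m) : enorm (x - y) = enorm (y - x).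
Proof. by rewrite -opprB !enormE dotvNl dotvC dotvNl opprK. Qed.

Lemma dotv_eq0 m (x : 'cV[R]_m) : (dotv x x == 0) = (x == 0).
Proof.
apply/idP/eqP => [/eqP H|->]; last first.
  by rewrite /dotv big1// => k _; rewrite mxE mul0r.
apply/matrixP => k j; rewrite (ord1 j) mxE.
have /eqP := H; rewrite psumr_eq0; last by move=> i _; rewrite -expr2 sqr_ge0.
by move/allP => /(_ k (mem_index_enum _)); rewrite mulf_eq0 orbb => /eqP.
Qed.

(* From [0 <= |a x - b y|^2] with [a = |y|], [b = |x|]. *)
Lemma dotv_le_enorm m (x y : 'cV[R]_m) : dotv x y <= enorm x * enorm y.
Proof.
have [x0|x0] := eqVneq (enorm x) 0.
  have : x = 0 by apply/eqP; rewrite -dotv_eq0 -sqr_enorm x0 expr0n.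
  move=> ->; rewrite /dotv big1 ?mulr_ge0 ?enorm_ge0// => k _.
  by rewrite mxE mul0r.
have [y0|y0] := eqVneq (enorm y) 0.
  have : y = 0 by apply/eqP; rewrite -dotv_eq0 -sqr_enorm y0 expr0n.
  move=> ->; rewrite /dotv big1 ?mulr_ge0 ?enorm_ge0// => k _.
  by rewrite mxE mulr0.
have xy : 0 < enorm x * enorm y by rewrite mulr_gt0// lt_neqAle eq_sym ?x0 ?y0 enorm_ge0.
have := dotv_ge0 (enorm y *: x - enorm x *: y).
rewrite dotvBB !dotvZl !(dotvC _ (_ *: _)) !dotvZl -!sqr_enorm.
rewrite (dotvC y x) => H; rewrite -(ler_pM2l xy); move: H.
set a := enorm x; set b := enorm y; nra.
Qed.

Lemma enormD m (x y : 'cV[R]_m) : enorm (x + y) <= enorm x + enorm y.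
Proof.
rewrite -(ler_pXn2r (n:=2))// ?nnegrE ?addr_ge0 ?enorm_ge0//.
rewrite sqr_enorm dotvDl !(dotvC _ (x + y)) !dotvDl (dotvC y x) -!sqr_enorm.
have := dotv_le_enorm x y; set a := enorm x; set b := enorm y; nra.
Qed.

Lemma sphereE t (x : 'cV[R]_t.+1) : @sphere R t x <-> dotv x x = 1.
Proof.
rewrite /sphere/= -sqr_enorm; split=> [->|H]; first by rewrite expr1n.
by apply/eqP; rewrite -(eqrXn2 (n:=2))// ?enorm_ge0// H expr1n.
Qed.

Lemma dotv_orth m (Q : 'M[R]_m) (x y : 'cV[R]_m) : Q^T *m Q = 1%:M ->
  dotv (Q *m x) (Q *m y) = dotv x y.
Proof.
move=> QQ; have : (Q *m x)^T *m (Q *m y) = x^T *m y.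
  by rewrite trmx_mul -mulmxA (mulmxA Q^T) QQ mul1mx.
by rewrite !dotvE => /matrixP/(_ ord0 ord0); rewrite !mxE eqxx !mulr1n.
Qed.

(* The witness is the Householder reflection in the hyperplane orthogonal to [u - v]. *)
Lemma reflection_exists m (u v : 'cV[R]_m) : dotv u u = 1 -> dotv v v = 1 ->
  exists Q : 'M[R]_m, [/\ Q^T = Q, Q *m Q = 1%:M & Q *m u = v].
Proof.
move=> u1 v1; have [->|uv] := eqVneq u v.
  by exists 1%:M; rewrite trmx1 !mul1mx.
pose w := u - v; pose s := dotv w w.
have s0 : s != 0 by rewrite dotv_eq0 subr_eq0.
have ws : w^T *m w = s%:M by rewrite dotvE.
have sE : s = 2 - 2 * dotv u v by rewrite /s /w dotvBB u1 v1; ring.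
have wu : w^T *m u = (s / 2)%:M.
  rewrite dotvE sE /w dotvDl dotvNl u1 (dotvC v u); congr (_%:M); by field.
exists (1%:M - (2 / s) *: (w *m w^T)); split.
- by rewrite linearB/= trmx1 linearZ/= trmx_mul trmxK.
- rewrite mulmxBl !mulmxBr !mul1mx mulmx1 -!scalemxAl -!scalemxAr.
  rewrite -!mulmxA (mulmxA w^T) ws mul_scalar_mx -scalemxAr !scalerA.
  rewrite (_ : 2 / s * (2 / s * s) = 2 / s + 2 / s); last by field.
  by rewrite scalerDl opprB addrK subrK.
- rewrite mulmxBl mul1mx -scalemxAl -mulmxA wu mul_mx_scalar scalerA.
  rewrite (_ : 2 / s * (s / 2) = 1) ?scale1r; last by field.
  by rewrite /w opprB addrC subrK.
Qed.

End euclid.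

Section borel_space.
Context {R : realType}.

Definition opens (m : nat) : set (set 'cV[R]_m) := [set U | open U].

(** [measurable] on this type unfolds to [borel], so the hypotheses on [borel] sets apply as they
    stand. *)
Definition bspace (m : nat) : measurableType (@opens m).-sigma :=
  g_sigma_algebraType (@opens m).

Lemma measurable_coord m (k : 'I_m) :
  measurable_fun [set: bspace m] (fun x : bspace m => (x : 'cV[R]_m) k ord0).
Proof.
apply: (measurability _ (RGenOpens.measurableE R)).
move=> _ [_ [a [b ->] <-]]; rewrite setTI; apply: sub_sigma_algebra.
rewrite /opens/=; apply: open_comp; last exact: interval_open.
by move=> x _; exact: coord_continuous.
Qed.

Lemma continuous_mulmx m (Q : 'M[R]_m) : continuous (fun x : 'cV[R]_m => Q *m x).
Proof.
move=> x A [P xP PA].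
(* A neighbourhood of a vector contains a product of neighbourhoods of its entries, so the
   coordinates can be treated one by one. *)
have cP i : \forall y \near x, P i ord0 ((Q *m y) i ord0).
  have c : continuous (fun y : 'cV[R]_m => (Q *m y) i ord0).
    rewrite (_ : (fun z => _) = fun z : 'cV[R]_m => \sum_k Q i k * z k ord0); last first.
      by apply/funext => z; rewrite mxE.
    apply: continuous_big => [|k _ y]; first exact: add_continuous.
    apply: (@continuousM R _ (fun=> Q i k) (fun z : 'cV[R]_m => z k ord0)); first exact: cst_continuous.
    exact: (@coord_continuous R m 1 k ord0 y).
  by apply: c; exact: xP.
have FF : Filter (nbhs (x : 'cV[R]_m)) by apply: nbhs_filter.
have := @filter_forall _ _ _ (nbhs (x : 'cV[R]_m)) FF cP.
apply: (@filterS _ _ FF) => y H; apply: PA => i j; rewrite (ord1 j); exact: H.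
Qed.

Lemma measurable_mulmx m (Q : 'M[R]_m) :
  measurable_fun [set: bspace m] (fun x : bspace m => (Q *m (x : 'cV[R]_m)) : bspace m).
Proof.
apply: (@measurability _ _ (bspace m) (bspace m) setT (fun x => (Q *m (x : 'cV[R]_m)) : bspace m) (@opens m) erefl).
move=> _ [A oA <-]; rewrite setTI; apply: sub_sigma_algebra.
by rewrite /opens/=; apply: open_comp => // x _; exact: continuous_mulmx.
Qed.

Lemma measurable_dotv d (T : measurableType d) m (f g : T -> bspace m) :
  measurable_fun setT f -> measurable_fun setT g ->
  measurable_fun setT (fun x => dotv (f x) (g x)).
Proof.
move=> mf mg; apply: measurable_sum => k; apply: measurable_funM.
- by apply: (measurableT_comp (measurable_coord k)).
- by apply: (measurableT_comp (measurable_coord k)).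
Qed.

Lemma measurable_enormB d (T : measurableType d) m (f g : T -> bspace m) :
  measurable_fun setT f -> measurable_fun setT g ->
  measurable_fun setT (fun x => enorm ((f x : 'cV_m) - (g x : 'cV_m))).
Proof.
move=> mf mg; under eq_fun do rewrite enormE.
apply: (@measurableT_comp _ _ _ _ _ _ (Num.sqrt : R -> R)).
  by apply: continuous_measurable_fun; exact: sqrt_continuous.
under eq_fun do rewrite dotvBB.
apply: measurable_funD; last exact: measurable_dotv.
apply: measurable_funB; first exact: measurable_dotv.
by apply: measurable_funM => //; exact: measurable_dotv.
Qed.

Lemma measurable_sphere t : measurable (@sphere R t : set (bspace t.+1)).
Proof.
rewrite (_ : @sphere R t = (fun x : bspace t.+1 => dotv x x) @^-1` [set 1]).
  rewrite -[X in measurable X]setTI; apply: (@measurable_dotv _ (bspace t.+1) _ id id) => //.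
by apply/seteqP; split => x /sphereE.
Qed.

End borel_space.

(** * Moments of a rotation-invariant law on the sphere *)

Section uniform.
Context {R : realType} (s : nat).
Local Notation T := (@bspace R s.+2).
Local Notation S := (@sphere R s.+1 : set T).
Variable mu : probability T R.
Hypothesis muS : mu S = 1%E.
Hypothesis muQ : forall Q : 'M[R]_s.+2, Q *m Q^T = 1%:M ->
  forall A : set T, measurable A -> mu [set x | A (Q *m x)] = mu A.

(** Boundedness is asked on the sphere only, which carries the law: polynomials in the coordinates
    are unbounded on the whole space. *)
Definition regular (f : T -> R) :=
  measurable_fun setT f /\ exists C, forall x, S x -> `|f x| <= C.

Definition expect (f : T -> R) : R := \int[mu]_(x in S) f x.

Lemma regular_integrable f : regular f -> mu.-integrable S (EFin \o f).
Proof.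
move=> [mf [C Cf]]; apply: measurable_bounded_integrable.
- exact: measurable_sphere.
- by rewrite /= muS ltry.
- exact: measurable_funTS.
- exists C; split; first exact: num_real.
  by move=> M CM x Sx /=; apply: (le_trans (Cf _ Sx)); exact: ltW.
Qed.

Lemma regular_cst c : regular (cst c).
Proof. by split => //; exists `|c|. Qed.

Lemma regularD f g : regular f -> regular g -> regular (fun x => f x + g x).
Proof.
move=> [mf [C Cf]] [mg [D Dg]]; split; first exact: measurable_funD.
exists (C + D) => x Sx; apply: (le_trans (ler_normD _ _)).
by rewrite lerD ?Cf ?Dg.
Qed.

Lemma regularM f g : regular f -> regular g -> regular (fun x => f x * g x).
Proof.
move=> [mf [C Cf]] [mg [D Dg]]; split; first exact: measurable_funM.
exists (C * D) => x Sx; rewrite normrM.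
by rewrite ler_pM ?Cf ?Dg.
Qed.

Lemma regularX f n : regular f -> regular (fun x => f x ^+ n).
Proof.
move=> [mf [C Cf]]; split; first exact: measurable_funX.
by exists (C ^+ n) => x Sx; rewrite normrX lerXn2r ?nnegrE ?Cf// (le_trans _ (Cf _ Sx)).
Qed.

Lemma regular_sum n (f : 'I_n -> T -> R) : (forall i, regular (f i)) ->
  regular (fun x => \sum_i f i x).
Proof.
elim: n f => [|n IH] f rf.
  by under eq_fun do rewrite big_ord0; exact: regular_cst.
under eq_fun do rewrite big_ord_recr /=.
by apply: regularD => //; exact: IH.
Qed.

Lemma regular_coord k : regular (fun x : T => (x : 'cV[R]_s.+2) k ord0).
Proof.
split; first exact: measurable_coord.
exists 1 => x /sphereE x1.
rewrite -(ler_pXn2r (n:=2))// ?nnegrE// expr1n real_normK ?num_real// -x1.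
rewrite /dotv (bigD1 k)//= expr2 lerDl sumr_ge0// => i _.
by rewrite -expr2 sqr_ge0.
Qed.

Lemma regular_mulmx f (Q : 'M[R]_s.+2) : Q^T *m Q = 1%:M -> regular f ->
  regular (fun x => f (Q *m (x : 'cV[R]_s.+2) : T)).
Proof.
move=> QQ [mf [C Cf]]; split.
  exact: (measurableT_comp mf (measurable_mulmx Q)).
exists C => x Sx; apply: Cf; apply/sphereE; rewrite dotv_orth//.
exact/sphereE.
Qed.

Lemma expect_cst c : expect (cst c) = c.
Proof.
by rewrite /expect Rintegral_cst /= ?muS ?mulr1//; exact: measurable_sphere.
Qed.

Lemma eq_expect f g : (forall x, S x -> f x = g x) -> expect f = expect g.
Proof. by move=> fg; apply: eq_Rintegral => x /set_mem; exact: fg. Qed.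

Lemma expectD f g : regular f -> regular g ->
  expect (fun x => f x + g x) = expect f + expect g.
Proof.
by move=> rf rg; apply: RintegralD; [exact: measurable_sphere|exact: regular_integrable..].
Qed.

Lemma expectZ c f : regular f -> expect (fun x => c * f x) = c * expect f.
Proof.
by move=> rf; apply: RintegralZl; [exact: measurable_sphere|exact: regular_integrable].
Qed.

Lemma expect_sum n (f : 'I_n -> T -> R) : (forall i, regular (f i)) ->
  expect (fun x => \sum_i f i x) = \sum_i expect (f i).
Proof.
elim: n f => [|n IH] f rf.
  rewrite big_ord0; under eq_fun do rewrite big_ord0; exact: expect_cst.
under eq_fun do rewrite big_ord_recr /=.
rewrite expectD// ?IH ?big_ord_recr//.
exact: regular_sum.
Qed.

Lemma le_expect f g : regular f -> regular g -> (forall x, S x -> f x <= g x) ->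
  expect f <= expect g.
Proof.
by move=> rf rg fg; apply: le_Rintegral => //;
  [exact: measurable_sphere|exact: regular_integrable..].
Qed.

Lemma mu_setIsphere (A : set T) : measurable A -> mu (A `&` S) = mu A.
Proof.
move=> mA; have mS := @measurable_sphere R s.+1.
have S0 : mu (~` S) = 0%E by rewrite probability_setC// muS subee.
rewrite [RHS](measureDI mu mA mS) /=.
rewrite (_ : mu (A `\` S) = 0%E) ?add0e//.
by apply: (subset_measure0 _ _ _ S0); [exact: measurableD|exact: measurableC|move=> x []].
Qed.

Lemma expect_indic (A : set T) : measurable A -> expect \1_A = fine (mu A).
Proof.
move=> mA; have mS := @measurable_sphere R s.+1.
by rewrite /expect /Rintegral integral_indic//= mu_setIsphere.
Qed.

Lemma regular_indic (A : set T) : measurable A -> regular \1_A.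
Proof.
move=> mA; split; first exact: measurable_indic.
by exists 1 => x _; rewrite indicE; case: (x \in A); rewrite ?normr1 ?normr0.
Qed.

(** By [muQ] the law is its own image under [Q], and the sphere is its own preimage; the rest is the
    change of variables formula. *)
Lemma expect_mulmx f (Q : 'M[R]_s.+2) : Q *m Q^T = 1%:M -> regular f ->
  expect (fun x => f (Q *m (x : 'cV[R]_s.+2) : T)) = expect f.
Proof.
move=> QQ rf; have QQ' : Q^T *m Q = 1%:M by exact: mulmx1C.
pose q (x : T) : T := Q *m (x : 'cV[R]_s.+2).
have mq : measurable_fun setT q := measurable_mulmx Q.
have qS : q @^-1` S = S.
  by apply/seteqP; split => x /sphereE H; apply/sphereE; move: H; rewrite dotv_orth.
rewrite /expect /Rintegral; congr fine.
rewrite -[in LHS]qS.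
rewrite -(@integral_pushforward _ _ _ _ R q mq mu S (EFin \o f)).
- by apply: eq_measure_integral => A mA _ /=; exact: muQ.
- by apply/measurable_EFinP; exact: rf.1.
- by rewrite qS; exact/regular_integrable/(regular_mulmx QQ').
- exact: measurable_sphere.
Qed.

End uniform.

Section poly_aux.
Context {R : realType}.

(** The difference vanishes at the integers [0, 1, 2, ...], of which as many are taken as its size:
    too many roots for a nonzero polynomial. *)
Lemma poly_horner_inj (p q : {poly R}) : (forall x, p.[x] = q.[x]) -> p = q.
Proof.
move=> pq; apply/eqP; rewrite -subr_eq0; apply/eqP.
pose rs := [seq i%:R : R | i <- iota 0 (size (p - q))].
apply: (@roots_geq_poly_eq0 _ _ rs).
- by apply/allP => x _; rewrite /root hornerD hornerN pq subrr.
- rewrite map_inj_in_uniq ?iota_uniq// => i j _ _ /eqP.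
  by rewrite eqr_nat => /eqP.
- by rewrite size_map size_iota.
Qed.

Lemma coef_1DX2_exp (k : nat) :
  (((1 + 'X^2) ^+ k : {poly R})`_0 = 1) * (((1 + 'X^2) ^+ k : {poly R})`_2 = k%:R).
Proof.
elim: k => [|k [IH0 IH2]]; first by rewrite expr0 !coef1.
rewrite exprS mulrDl mul1r !coefD !coefXnM/= IH0 IH2 addr0; split=> //.
by rewrite natr1.
Qed.

End poly_aux.

Section moments.
Context {R : realType} (s : nat).
Local Notation T := (@bspace R s.+2).
Local Notation S := (@sphere R s.+1 : set T).
Variable mu : probability T R.
Hypothesis muS : mu S = 1%E.
Hypothesis muQ : forall Q : 'M[R]_s.+2, Q *m Q^T = 1%:M ->
  forall A : set T, measurable A -> mu [set x | A (Q *m x)] = mu A.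

Local Notation expect := (@expect R s mu).
Local Notation crd k := (fun x : T => (x : 'cV[R]_s.+2) k ord0).

Definition basis_vec (k : 'I_s.+2) : 'cV[R]_s.+2 := delta_mx k ord0.

Lemma dotv_basis k (x : 'cV[R]_s.+2) : dotv (basis_vec k) x = x k ord0.
Proof.
rewrite /dotv (bigD1 k)//= mxE !eqxx mul1r big1 ?addr0// => i ik.
by rewrite mxE (negbTE ik) mul0r.
Qed.

(** A reflection takes the first basis vector to [u], and invariance of the law removes it from the
    expectation. *)
Lemma expect_dotv_exp (u : 'cV[R]_s.+2) n : dotv u u = 1 ->
  expect (fun x : T => dotv u (x : 'cV[R]_s.+2) ^+ n) =
  expect (fun x : T => (x : 'cV[R]_s.+2) ord0 ord0 ^+ n).
Proof.
move=> u1; have e1 : dotv (basis_vec ord0) (basis_vec ord0) = 1.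
  by rewrite dotv_basis mxE !eqxx.
have [Q [QT QQ Qe]] := reflection_exists e1 u1.
rewrite -[RHS](@expect_mulmx _ _ _ muS muQ _ Q).
- apply: eq_expect => x _; congr (_ ^+ _); rewrite -dotv_basis.
  have : u^T *m x = (basis_vec ord0)^T *m (Q *m x) by rewrite -Qe trmx_mul QT mulmxA.
  by rewrite !dotvE => /matrixP/(_ ord0 ord0); rewrite !mxE eqxx !mulr1n.
- by rewrite QT.
- exact/regularX/regular_coord.
Qed.

(* Comparison of the coefficients of [e ^+ 2] in
   [E (x_0 + e x_i) ^ (2k + 2) = (1 + e ^ 2) ^ (k + 1) * E x_0 ^ (2k + 2)]. *)
Lemma moment_coord (i : 'I_s.+2) k : i != ord0 ->
  (k.*2.+1)%:R * expect (fun x => crd ord0 x ^+ k.*2 * crd i x ^+ 2) =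
  expect (fun x => crd ord0 x ^+ k.+1.*2).
Proof.
move=> i0; set n := k.+1.*2; set m := expect (fun x => crd ord0 x ^+ n).
pose a j := expect (fun x => crd ord0 x ^+ (n - j) * crd i x ^+ j).
(* As polynomials in [e], [p] is the binomial expansion of the moment and [q] the value that
   invariance imposes; they agree at every real [e]. *)
pose p : {poly R} := \poly_(j < n.+1) (('C(n, j))%:R * a j).
pose q : {poly R} := m *: (1 + 'X^2) ^+ k.+1.
have ra j : regular (fun x : T => crd ord0 x ^+ (n - j) * crd i x ^+ j).
  by apply: regularM; exact/regularX/regular_coord.
have pq : p = q.
  apply: poly_horner_inj => e.
  pose r := 1 + e ^+ 2; have r0 : 0 < r by rewrite ltr_wpDr// sqr_ge0.
  pose u := (Num.sqrt r)^-1 *: (basis_vec ord0 + e *: basis_vec i).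
  have sr0 : Num.sqrt r != 0 by rewrite gt_eqF// sqrtr_gt0.
  have ux (x : 'cV[R]_s.+2) : dotv u x = (Num.sqrt r)^-1 * (x ord0 ord0 + e * x i ord0).
    by rewrite /u dotvZl dotvDl dotvZl !dotv_basis.
  have u1 : dotv u u = 1.
    rewrite ux !mxE !eqxx (negbTE i0) (eq_sym ord0) (negbTE i0)/= !mulr0 addr0 add0r !mulr1.
    set c := (Num.sqrt r)^-1; transitivity (c ^+ 2 * r); first by rewrite /r; ring.
    by rewrite /c exprVn sqr_sqrtr ?ltW// mulVf// gt_eqF.
  have ru : regular (fun x : T => dotv u (x : 'cV[R]_s.+2)).
    under eq_fun do rewrite ux.
    apply: (@regularM _ _ (cst _)); first exact: regular_cst.
    apply: regularD; first exact: regular_coord.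
    by apply: (@regularM _ _ (cst _)); [exact: regular_cst|exact: regular_coord].
  have := expect_dotv_exp n u1; rewrite -/m => H.
  rewrite /p horner_poly /q hornerZ horner_exp !hornerE -/r.
  transitivity (Num.sqrt r ^+ n * expect (fun x : T => dotv u (x : 'cV[R]_s.+2) ^+ n)); last first.
    by rewrite H /n -muln2 mulnC exprM sqr_sqrtr ?ltW// mulrC.
  rewrite -expectZ//; last exact: regularX ru.
  transitivity (expect (fun x => \sum_(j < n.+1) (('C(n, j))%:R * e ^+ j) * (crd ord0 x ^+ (n - j) * crd i x ^+ j))).
    rewrite expect_sum//; last first.
      by move=> j; apply: regularM => //; exact: regular_cst.
    by apply: eq_bigr => j _; rewrite expectZ// mulrAC.
  apply: eq_expect => x _; rewrite -exprMn ux mulVKf// exprDn.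
  apply: eq_bigr => j _; rewrite exprMn -mulr_natl; ring.
have := congr1 (fun P : {poly R} => P`_2) pq.
rewrite /p /q coef_poly coefZ !coef_1DX2_exp.
rewrite (_ : (2 < n.+1)%N); last by rewrite /n doubleS.
have -> : a 2 = expect (fun x => crd ord0 x ^+ k.*2 * crd i x ^+ 2).
  by rewrite /a /n doubleS !subSS subn0.
set A := expect _.
(* The factor [k + 1] of this binomial coefficient cancels against the coefficient of ['X^2] in
   [q]. *)
have -> : 'C(n, 2)%:R = k.+1%:R * k.*2.+1%:R :> R.
  by rewrite -natrM bin2 /n -doubleMl doubleK doubleS.
rewrite -mulrA (mulrC m) => /mulfI; apply.
by rewrite pnatr_eq0.
Qed.

(** On the sphere the squares of the other [s + 1] coordinates add up to [1 - x_0 ^ 2], and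
    [moment_coord] gives each of them the same contribution. *)
Lemma moment_rec k :
  s.+1%:R * expect (fun x => crd ord0 x ^+ k.+1.*2) =
  (k.*2.+1)%:R * (expect (fun x => crd ord0 x ^+ k.*2) -
                  expect (fun x => crd ord0 x ^+ k.+1.*2)).
Proof.
have r0 : regular (fun x : T => crd ord0 x ^+ k.*2) by exact/regularX/regular_coord.
have r1 : regular (fun x : T => crd ord0 x ^+ k.+1.*2) by exact/regularX/regular_coord.
have ri (i : 'I_s.+1) : regular (fun x : T => crd ord0 x ^+ k.*2 * crd (lift ord0 i) x ^+ 2).
  by apply: regularM => //; exact/regularX/regular_coord.
have E : expect (fun x => crd ord0 x ^+ k.*2) = expect (fun x => crd ord0 x ^+ k.+1.*2) +
    \sum_(i < s.+1) expect (fun x => crd ord0 x ^+ k.*2 * crd (lift ord0 i) x ^+ 2).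
  rewrite -expect_sum// -expectD//; last exact: regular_sum.
  apply: eq_expect => x /sphereE; rewrite /dotv big_ord_recl => x1.
  rewrite -mulr_sumr doubleS -(addn2 k.*2) exprD -mulrDr.
  under eq_bigr do rewrite expr2.
  by rewrite expr2 x1 mulr1.
rewrite E addrC addKr mulr_sumr.
under eq_bigr do rewrite moment_coord//.
by rewrite sumr_const card_ord mulr_natl.
Qed.

Lemma moment_cossin k :
  expect (fun x => crd ord0 x ^+ k.*2) = cossin_int k.*2 s / cossin_int 0 s.
Proof.
have W0 : @cossin_int R 0 s != 0 by rewrite gt_eqF// cossin_int0_gt0.
elim: k => [|k IH].
  by rewrite divff// (_ : (fun x => _) = cst 1) ?expect_cst.
(* The recursion has the new moment on both sides; collecting it produces this factor. *)
have sk0 : s.+1%:R + k.*2.+1%:R != 0 :> R by rewrite -natrD pnatr_eq0.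
apply: (mulfI sk0).
have := moment_rec k; have := @cossin_int_parts R k.*2 s; have := @cossin_intS R k.*2 s.
rewrite IH -doubleS => -> H1 H2.
rewrite mulrDl H2 mulrA mulrDl.
rewrite (_ : s.+1%:R * cossin_int k.+1.*2 s = k.*2.+1%:R * (cossin_int k.*2 s - cossin_int k.+1.*2 s))//.
rewrite -[in RHS]mulrDr subrK mulrBr subrK mulrA//.
Qed.

Lemma Rintegral_sum_continuous n (f : 'I_n -> R -> R) (a b : R) :
  (forall i, continuous (f i)) ->
  \int[lebesgue_measure]_(x in `[a, b]) (\sum_i f i x) =
  \sum_i \int[lebesgue_measure]_(x in `[a, b]) f i x.
Proof.
elim: n f => [|n IH] f cf.
  by rewrite big_ord0; under eq_Rintegral do rewrite big_ord0; rewrite Rintegral_cst// mul0r.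
under eq_Rintegral do rewrite big_ord_recr /=.
rewrite RintegralD//; last 2 first.
- apply: integrable_itvcc; apply: continuous_big => [|i _]; last exact: cf.
  exact: add_continuous.
- exact: integrable_itvcc.
by rewrite IH// big_ord_recr.
Qed.

(** Linear extension of [moment_cossin]: polynomials in the square cannot tell the first coordinate
    from [cos] under the weight [sin ^ s]. *)
Lemma expect_poly (p : {poly R}) :
  expect (fun x => p.[crd ord0 x ^+ 2]) * cossin_int 0 s =
  \int[lebesgue_measure]_(x in `[0, pi / 2]) (p.[cos x ^+ 2] * sin x ^+ s).
Proof.
have W0 : @cossin_int R 0 s != 0 by rewrite gt_eqF// cossin_int0_gt0.
under eq_fun do rewrite horner_coef.
rewrite expect_sum//; last first.
  move=> i; apply: (@regularM _ _ (cst _)); first exact: regular_cst.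
  exact/regularX/regularX/regular_coord.
transitivity (\int[lebesgue_measure]_(x in `[0, pi / 2])
    (\sum_(i < size p) p`_i * (cos x ^+ i.*2 * sin x ^+ s))); last first.
  apply: eq_Rintegral => x _; rewrite horner_coef mulr_suml.
  by apply: eq_bigr => i _; rewrite -exprM mulrA mul2n.
rewrite Rintegral_sum_continuous; last first.
  move=> i x; apply: (@cvgM _ _ _ _ (cst _)); first exact: cvg_cst.
  exact: continuous_cossin.
rewrite mulr_suml; apply: eq_bigr => i _.
under eq_fun do rewrite -exprM mul2n.
rewrite expectZ//; last exact/regularX/regular_coord.
rewrite moment_cossin RintegralZl//; last exact/integrable_itvcc/continuous_cossin.
by rewrite -mulrA divfK.
Qed.

End moments.

(** * From moments to the measure of caps *)

Section kernel.
Context {R : realType}.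

Lemma bernoulli_le (z : R) n : 0 <= z <= 1 -> 1 - n%:R * z <= (1 - z) ^+ n.
Proof.
move=> /andP[z0 z1]; elim: n => [|n IH]; first by rewrite mul0r subr0 expr0.
have z1' : 0 <= 1 - z by rewrite subr_ge0.
rewrite exprS; apply: le_trans (ler_wpM2l z1' IH).
rewrite -natr1; have : 0 <= n%:R * z * z by rewrite !mulr_ge0.
by nra.
Qed.

(** Bernoulli's inequality for [1 + z], together with [(1 - z) * (1 + z) <= 1]. It makes
    [(1 - z) ^ n] small once [n z] is large. *)
Lemma bernoulli_le_inv (z : R) n : 0 <= z <= 1 -> (1 - z) ^+ n * (1 + n%:R * z) <= 1.
Proof.
move=> /andP[z0 z1].
have z1' : 0 <= 1 - z by rewrite subr_ge0.
apply: (@le_trans _ _ ((1 - z) ^+ n * (1 + z) ^+ n)).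
  rewrite ler_wpM2l ?exprn_ge0//.
  elim: n => [|n IH]; first by rewrite mul0r addr0 expr0.
  have z1'' : 0 <= 1 + z by rewrite addr_ge0.
  rewrite exprS; apply: le_trans (ler_wpM2l z1'' IH).
  rewrite -natr1; have : 0 <= n%:R * z * z by rewrite !mulr_ge0.
  by nra.
rewrite -exprMn exprn_ile1//; nra.
Qed.

(* [(1 - y ^ n) ^ (k ^ n)] tends to [1] for [0 <= y < 1/k] and to [0] for
   [1/k < y <= 1]; with [y = v / (k a b)] the threshold is at [v = a b]. *)
Definition step_poly (a b : R) (k n : nat) : {poly R} :=
  (1 - ((k%:R * (a * b))^-1 *: (1 - 'X)) ^+ n) ^+ (k ^ n).

Lemma horner_step_poly a b k n x :
  (step_poly a b k n).[x] = (1 - ((k%:R * (a * b))^-1 * (1 - x)) ^+ n) ^+ (k ^ n).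
Proof. by rewrite /step_poly !(hornerE, horner_exp). Qed.

Section step.
Variables (a b : R) (k n : nat) (x : R).
Hypotheses (a0 : 0 < a) (ab : a < b) (kab : 1 <= k%:R * (a * b)) (x01 : 0 <= x <= 1).

Let c0 : 0 < k%:R * (a * b). Proof. exact: lt_le_trans kab. Qed.

Let b0 : 0 < b. Proof. exact: lt_trans ab. Qed.

Let y := (k%:R * (a * b))^-1 * (1 - x).

(** The integer [k] is taken large enough for [1 - x <= k a b], which keeps [y ^ n] in the range of
    Bernoulli's inequality. *)
Let y01 : 0 <= y <= 1.
Proof.
have /andP[x0 x1] := x01.
rewrite /y mulr_ge0 ?subr_ge0 ?invr_ge0 ?(ltW c0)//= mulrC ler_pdivrMr// mul1r.
by apply: le_trans kab; rewrite lerBlDr lerDl.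
Qed.

Let yn01 : 0 <= y ^+ n <= 1.
Proof. by have /andP[y0 y1] := y01; rewrite exprn_ge0//= exprn_ile1. Qed.

Lemma step_poly_01 : 0 <= (step_poly a b k n).[x] <= 1.
Proof.
rewrite horner_step_poly -/y; have /andP[y0 y1] := yn01.
by rewrite exprn_ge0 ?subr_ge0//= exprn_ile1 ?subr_ge0// lerBlDr lerDl.
Qed.

Let knyn : (k ^ n)%:R * y ^+ n = ((1 - x) / (a * b)) ^+ n.
Proof.
rewrite natrX -exprMn; congr (_ ^+ _); rewrite /y.
have k0 : k%:R != 0 :> R by apply: contraTneq c0 => ->; rewrite mul0r ltxx.
by field; rewrite k0 !gt_eqF.
Qed.

(** The threshold [a b] is the geometric mean of [a ^ 2] and [b ^ 2]: the ratio [(1 - x) / (a b)] is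
    at most [a / b] when [1 - x <= a ^ 2], and at least [b / a] when [b ^ 2 <= 1 - x]. Both sides
    thus have the same error [(a / b) ^ n]. *)
Lemma step_poly_ge : 1 - x <= a ^+ 2 -> 1 - (a / b) ^+ n <= (step_poly a b k n).[x].
Proof.
move=> xa; rewrite horner_step_poly -/y.
apply: le_trans (bernoulli_le _ yn01); rewrite knyn lerD2l lerN2.
have /andP[x0 x1] := x01.
rewrite lerXn2r ?nnegrE ?divr_ge0 ?subr_ge0 ?mulr_ge0 ?(ltW a0) ?(ltW b0)//.
rewrite ler_pdivrMr ?mulr_gt0// (_ : a / b * (a * b) = a ^+ 2)//.
by field; rewrite gt_eqF.
Qed.

Lemma step_poly_le : b ^+ 2 <= 1 - x -> (step_poly a b k n).[x] <= (a / b) ^+ n.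
Proof.
move=> xb; rewrite horner_step_poly -/y.
have := bernoulli_le_inv (k ^ n) yn01; rewrite knyn => H.
have ba0 : 0 < b / a by rewrite divr_gt0.
have yn : (b / a) ^+ n <= ((1 - x) / (a * b)) ^+ n.
  have /andP[x0 x1] := x01.
  rewrite lerXn2r ?nnegrE ?divr_ge0 ?subr_ge0 ?mulr_ge0 ?(ltW a0) ?(ltW b0)//.
  rewrite ler_pdivlMr ?mulr_gt0// (_ : b / a * (a * b) = b ^+ 2)//.
  by field; rewrite gt_eqF.
have q0 : 0 <= (1 - y ^+ n) ^+ (k ^ n).
  by rewrite exprn_ge0 ?subr_ge0//; case/andP: yn01.
rewrite -[a / b]invf_div exprVn -[leRHS]mul1r ler_pdivlMr ?exprn_gt0//.
apply: le_trans H; rewrite ler_wpM2l// (le_trans yn)// lerDr//.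
Qed.

End step.

Lemma le0_geometric (x r : R) (C : R) : 0 <= r < 1 -> (forall n, x <= C * r ^+ n) -> x <= 0.
Proof.
move=> /andP[r0 r1] H.
have c : (C * r ^+ n) @[n --> \oo] --> (C * 0 : R).
  by apply: cvgM; [exact: cvg_cst|apply: cvg_expr; rewrite ger0_norm].
rewrite -(mulr0 C) -(cvg_lim _ c)//; apply: limr_ge; first exact: cvgP c.
by apply: nearW => n; exact: H.
Qed.

Lemma right_limit_le (f : R -> R) (x u C : R) : x < u -> {for x, continuous f} ->
  (forall y, x < y < u -> C <= f y) -> C <= f x.
Proof.
move=> xu cf H; rewrite leNgt; apply/negP => fC.
have c : f y @[y --> x^'+] --> f x by apply: cvg_at_right_filter.
have n1 := @cvgr_lt _ _ _ (at_right_proper_filter x) _ (f x) c _ fC. have n2 : \forall y \near x^'+, f y < C /\ x < y < u.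
  near=> y; split; first by near: y; exact: n1.
  apply/andP; split.
    by near: y; exact: nbhs_right_gt.
  by near: y; exact: nbhs_right_lt.
have [y [fy /H]] := @filter_ex _ _ (at_right_proper_filter x) _ n2.
by rewrite leNgt fy.
Unshelve. all: by end_near. Qed.

Lemma left_limit_ge (f : R -> R) (x u C : R) : u < x -> {for x, continuous f} ->
  (forall y, u < y < x -> f y <= C) -> f x <= C.
Proof.
move=> xu cf H; rewrite leNgt; apply/negP => fC.
have c : f y @[y --> x^'-] --> f x by apply: cvg_at_left_filter.
have n1 := @cvgr_gt _ _ _ (at_left_proper_filter x) _ (f x) c _ fC. have n2 : \forall y \near x^'-, C < f y /\ u < y < x.
  near=> y; split; first by near: y; exact: n1.
  apply/andP; split.
    by near: y; exact: nbhs_left_gt.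
  by near: y; exact: nbhs_left_lt.
have [y [fy /H]] := @filter_ex _ _ (at_left_proper_filter x) _ n2.
by rewrite leNgt fy.
Unshelve. all: by end_near. Qed.

Lemma measurable_set_le (r : R) : measurable [set u : R | u <= r].
Proof.
have -> : [set u : R | u <= r] = `]-oo, r]%classic.
  by apply/seteqP; split => u /=; rewrite in_itv.
exact: measurable_itv.
Qed.

Lemma Rintegral_split (f : R -> R) (a b c : R) : continuous f -> a <= b -> b <= c ->
  \int[lebesgue_measure]_(x in `[a, c]) f x =
  \int[lebesgue_measure]_(x in `[a, b]) f x + \int[lebesgue_measure]_(x in `[b, c]) f x.
Proof.
move=> cf ab bc.
have i1 := @integrable_itvcc R f a c cf; have i2 := @integrable_itvcc R f b c cf.
have := @Rintegral_itvB R f (BLeft a) (BRight c) b i1; rewrite !bnd_simp => /(_ ab bc).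
rewrite Rintegral_itv_obnd_cbnd; last first.
  apply: integrableS i2 => // x /=; rewrite !in_itv/= => /andP[/ltW -> ->]//.
by move=> <-; rewrite addrC subrK.
Qed.

End kernel.

Section tail.
Context {R : realType} (s : nat).
Local Notation T := (@bspace R s.+2).
Local Notation S := (@sphere R s.+1 : set T).
Variable mu : probability T R.
Hypothesis muS : mu S = 1%E.
Hypothesis muQ : forall Q : 'M[R]_s.+2, Q *m Q^T = 1%:M ->
  forall A : set T, measurable A -> mu [set x | A (Q *m x)] = mu A.

Local Notation expect := (@expect R s mu).
Local Notation crd k := (fun x : T => (x : 'cV[R]_s.+2) k ord0).
Local Notation W := (@cossin_int R 0 s).

(** On the sphere and for [a > 0], two opposite caps: the points whose angle with the first axis has
    sine at most [a] in absolute value. Only [x_0 ^ 2] enters, which even moments can see. *)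
Definition double_cap (a : R) : set T := [set x | 1 - crd ord0 x ^+ 2 <= a ^+ 2].

Lemma measurable_double_cap a : measurable (double_cap a).
Proof.
rewrite (_ : double_cap a = (fun x : T => 1 - crd ord0 x ^+ 2) @^-1` `]-oo, a ^+ 2]).
  rewrite -[X in measurable X]setTI.
  have m : measurable_fun setT (fun x : T => 1 - crd ord0 x ^+ 2).
    by apply: measurable_funB => //; apply: measurable_funX; exact: measurable_coord.
  exact: m.
by apply/seteqP; split => x; rewrite /double_cap/= in_itv.
Qed.

Lemma regular_horner (p : {poly R}) : regular (fun x : T => p.[crd ord0 x ^+ 2]).
Proof.
under eq_fun do rewrite horner_coef.
apply: regular_sum => i; apply: (@regularM _ _ (cst _)); first exact: regular_cst.
exact/regularX/regularX/regular_coord.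
Qed.

Lemma crd_sq_01 (x : T) : S x -> 0 <= crd ord0 x ^+ 2 <= 1.
Proof.
move=> /sphereE x1; rewrite sqr_ge0/= -x1 /dotv (bigD1 ord0)//= expr2 lerDl.
by apply: sumr_ge0 => i _; rewrite -expr2 sqr_ge0.
Qed.

Lemma continuous_horner_cos (p : {poly R}) : continuous (fun x : R => p.[cos x ^+ 2] * sin x ^+ s).
Proof.
under eq_fun do rewrite horner_coef mulr_suml.
apply: continuous_big => [|i _ x]; first exact: add_continuous.
under eq_fun do rewrite -exprM -mulrA.
apply: (@cvgM _ _ _ _ (cst _)); first exact: cvg_cst.
exact: continuous_cossin.
Qed.

Section angles.
Variables (a b : R).
Hypotheses (a0 : 0 < a) (ab : a < b) (b1 : b < 1).

Let b0 : 0 < b := lt_trans a0 ab.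
Let a1 : a < 1 := lt_trans ab b1.
Let eta01 : 0 <= a / b < 1.
Proof. by rewrite divr_ge0 ?ltW//= ltr_pdivrMr// mul1r. Qed.

Lemma asin_itv (c : R) : 0 < c < 1 ->
  [/\ 0 <= asin c, asin c <= pi / 2, sin (asin c) = c & 0 < cos (asin c)].
Proof.
move=> /andP[c0 c1].
have c11 : -1 <= c <= 1 by rewrite ltW ?(lt_trans _ c0)//= ltW.
have sc : sin (asin c) = c by rewrite asinK// in_itv.
split=> //; last 1 first.
- rewrite cos_asin// sqrtr_gt0 subr_gt0 expr_lt1//; exact: ltW.
- rewrite leNgt; apply/negP => n0.
  have pi20 : 0 <= pi / 2 :> R by rewrite divr_ge0// pi_ge0.
  have : sin (asin c) < sin 0.
    by rewrite ltr_sin// in_itv/= ?asin_geNpi2 ?asin_lepi2//= oppr_le0 pi20.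
  by rewrite sc sin0 ltNge (ltW c0).
- by rewrite asin_lepi2.
Qed.

Let g k n (x : R) := (step_poly a b k n).[cos x ^+ 2] * sin x ^+ s.

Let mono_sin (x y : R) : 0 <= x -> x <= y -> y <= pi / 2 -> sin x <= sin y.
Proof.
move=> x0 xy y2; have pi20 : 0 <= pi / 2 :> R by rewrite divr_ge0// pi_ge0.
rewrite le_eqVlt in xy; case/predU1P : xy => [->//|xy].
apply/ltW; rewrite ltr_sin// in_itv/=.
  by rewrite (le_trans _ x0) ?oppr_le0//= (le_trans (ltW xy)).
by rewrite y2 andbT (le_trans _ (le_trans x0 (ltW xy)))// oppr_le0.
Qed.

Let cos_sq_01 (x : R) : 0 <= cos x ^+ 2 <= 1.
Proof. by rewrite sqr_ge0/= cos2sin2 lerBlDr lerDl sqr_ge0. Qed.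

Let cg k n : continuous (g k n).
Proof. exact: continuous_horner_cos. Qed.

Let csin : continuous (fun x : R => sin x ^+ s).
Proof.
rewrite (_ : (fun x => _) = fun x : R => cos x ^+ 0 * sin x ^+ s).
  exact: continuous_cossin.
by apply/funext => x; rewrite expr0 mul1r.
Qed.

Let cost : continuous (fun x : R => sin x ^+ s * cos x).
Proof.
rewrite (_ : (fun x => _) = fun x : R => cos x ^+ 1 * sin x ^+ s).
  exact: continuous_cossin.
by apply/funext => x; rewrite expr1 mulrC.
Qed.

Let RintegralSc (u : R) : 0 <= u ->
  \int[lebesgue_measure]_(x in `[0, u]) (sin x ^+ s * cos x) = sin u ^+ s.+1 / s.+1%:R.
Proof.
move=> u0; have dF (x : R) : is_derive x 1 (fun y => s.+1%:R^-1 * sin y ^+ s.+1) (sin x ^+ s * cos x).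
  have := is_derive_mul (is_derive_cst (s.+1%:R^-1 : R) x 1) (is_derive_powS s (is_derive_sin x)).
  congr (is_derive _ _ _ _); rewrite mulr0 addr0/= !mulrA mulVf ?pnatr_eq0//.
  by rewrite mul1r.
rewrite (RintegralF u0 dF); first by rewrite sin0 expr0n/= mulr0 subr0 mulrC.
exact: cost.
Qed.

Let sin0pi (x : R) : 0 <= x -> x <= pi / 2 -> 0 <= sin x.
Proof. by move=> x0 x2; rewrite -[leLHS](@sin0 R) mono_sin. Qed.

(** The interval is split at [asin b]. Before it the polynomial is at most [1] and
    [cos x >= sqrt (1 - b ^ 2)], so [sin ^ s] is dominated by a multiple of [sin ^ s * cos], which
    has a primitive. After it [sin x >= b], and the polynomial is at most [(a / b) ^ n]. *)
Let int_upper k n (kab : 1 <= k%:R * (a * b)) :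
  \int[lebesgue_measure]_(x in `[0, pi / 2]) g k n x <=
  b ^+ s.+1 / (s.+1%:R * Num.sqrt (1 - b ^+ 2)) + (a / b) ^+ n * W.
Proof.
have [B0 B2 sB cB] := asin_itv (introT andP (conj b0 b1)).
set B := asin b in B0 B2 sB cB.
have en : 0 <= (a / b) ^+ n by rewrite exprn_ge0//; case/andP: eta01.
rewrite (Rintegral_split (@cg k n) B0 B2) lerD//.
- apply: (@le_trans _ _ (\int[lebesgue_measure]_(x in `[0, B]) ((cos B)^-1 * (sin x ^+ s * cos x)))).
    apply: le_Rintegral => //; [apply: integrable_itvcc; exact: cg| |].
      apply: integrable_itvcc => x; apply: (@cvgM _ _ _ _ (cst _)); first exact: cvg_cst.
      exact: cost.
    move=> x; rewrite /= in_itv/= => /andP[x0 xB].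
    have sx : 0 <= sin x ^+ s by rewrite exprn_ge0// sin0pi// (le_trans xB).
    have /andP[q0 q1] := step_poly_01 n kab (cos_sq_01 x).
    apply: (@le_trans _ _ (sin x ^+ s)); first by rewrite ler_piMl.
    rewrite mulrCA ler_peMr// mulrC ler_pdivlMr// mul1r.
    have pi2 : pi / 2 <= pi :> R by rewrite ler_pdivrMr// ler_peMr// ?pi_ge0// ler1n.
    rewrite leNgt ltr_cos -?leNgt// in_itv/= ?x0 ?B0 ?(le_trans B2 pi2)//.
    by rewrite (le_trans xB)// (le_trans B2).
  rewrite RintegralZl//; last by apply: integrable_itvcc; exact: cost.
  have -> : cos B = Num.sqrt (1 - b ^+ 2).
    by rewrite /B cos_asin// (ltW b1) andbT (le_trans _ (ltW b0))// lerN10.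
  by rewrite RintegralSc// sB [leLHS]mulrC invfM mulrA.
- apply: (@le_trans _ _ (\int[lebesgue_measure]_(x in `[B, pi / 2]) ((a / b) ^+ n * sin x ^+ s))).
    apply: le_Rintegral => //; [apply: integrable_itvcc; exact: cg| |].
      apply: integrable_itvcc => x; apply: (@cvgM _ _ _ _ (cst _)); first exact: cvg_cst.
      exact: csin.
    move=> x; rewrite /= in_itv/= => /andP[Bx x2].
    rewrite ler_wpM2r ?exprn_ge0 ?sin0pi ?(le_trans B0 Bx)//.
    apply: step_poly_le => //.
    rewrite -sin2cos2 lerXn2r ?nnegrE ?(ltW b0) ?sin0pi ?(le_trans B0 Bx)//.
    by rewrite -sB mono_sin.
  rewrite RintegralZl//; last by apply: integrable_itvcc; exact: csin.
  rewrite ler_wpM2l// /cossin_int.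
  under [leRHS]eq_Rintegral do rewrite mul1r.
  rewrite (Rintegral_split (@csin) B0 B2) lerDr.
  apply: Rintegral_ge0 => x /=; rewrite in_itv/= => /andP[x0 xB].
  by rewrite exprn_ge0// sin0pi// (le_trans xB).
Qed.

(** Only [[0, asin a]] is kept: there [sin x <= a], so the polynomial is close to [1], and [sin ^ s]
    is at least [sin ^ s * cos]. *)
Let int_lower k n (kab : 1 <= k%:R * (a * b)) :
  (1 - (a / b) ^+ n) * (a ^+ s.+1 / s.+1%:R) <=
  \int[lebesgue_measure]_(x in `[0, pi / 2]) g k n x.
Proof.
have [B0 B2 sB cB] := asin_itv (introT andP (conj a0 a1)).
set B := asin a in B0 B2 sB cB.
have en : 0 <= 1 - (a / b) ^+ n.
  by case/andP: eta01 => e0 e1; rewrite subr_ge0 exprn_ile1// ltW.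
rewrite (Rintegral_split (@cg k n) B0 B2) -[leLHS]addr0 lerD//.
- apply: (@le_trans _ _ (\int[lebesgue_measure]_(x in `[0, B]) ((1 - (a / b) ^+ n) * (sin x ^+ s * cos x)))).
    by rewrite RintegralZl//; [rewrite RintegralSc// sB|apply: integrable_itvcc; exact: cost].
  apply: le_Rintegral => //; [|apply: integrable_itvcc; exact: cg|].
    apply: integrable_itvcc => x; apply: (@cvgM _ _ _ _ (cst _)); first exact: cvg_cst.
    exact: cost.
  move=> x; rewrite /= in_itv/= => /andP[x0 xB].
  have sx : 0 <= sin x by rewrite sin0pi// (le_trans xB).
  have sxs : 0 <= sin x ^+ s by rewrite exprn_ge0.
  apply: (@le_trans _ _ ((1 - (a / b) ^+ n) * sin x ^+ s)).
    by rewrite ler_wpM2l// ler_piMr// cos_le1.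
  rewrite ler_wpM2r// step_poly_ge//.
  by rewrite -sin2cos2 lerXn2r ?nnegrE ?(ltW a0)// -sB mono_sin.
- apply: Rintegral_ge0 => x /=; rewrite in_itv/= => /andP[Bx x2].
  have /andP[q0 q1] := step_poly_01 n kab (cos_sq_01 x).
  by rewrite mulr_ge0// exprn_ge0// sin0pi// (le_trans B0).
Qed.

Let kexists : exists k : nat, 1 <= k%:R * (a * b).
Proof.
have ab0 : 0 < a * b by rewrite mulr_gt0.
exists (Num.bound (a * b)^-1).
rewrite -ler_pdivrMr// mul1r; apply/ltW.
by apply: archi_boundP; rewrite invr_ge0 ltW.
Qed.

(** On the double cap of [a] the step polynomial is at least [1 - (a / b) ^ n], and its expectation
    is controlled by [int_upper]. The gap [a < b] makes the error vanish as [n] grows; it is closed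
    afterwards by continuity in [b]. *)
Lemma double_cap_le_aux :
  fine (mu (double_cap a)) <= b ^+ s.+1 / (s.+1%:R * W * Num.sqrt (1 - b ^+ 2)).
Proof.
have [k K] := kexists.
(* The constant [2] counts the tail term of [int_upper] and the loss [e * m <= e]. *)
rewrite -subr_le0; apply: (le0_geometric eta01 (C := 2)) => n.
set e := (a / b) ^+ n.
have W0 := @cossin_int0_gt0 R s.
have e01 : 0 <= e by rewrite exprn_ge0//; case/andP: eta01.
set m := fine _; have m1 : m <= 1.
  rewrite -lee_fin fineK ?fin_num_measure//; last exact: measurable_double_cap.
  by apply: probability_le1; exact: measurable_double_cap.
have m0 : 0 <= m by rewrite fine_ge0.
have H : (1 - e) * m <= expect (fun x => (step_poly a b k n).[crd ord0 x ^+ 2]).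
  rewrite /m -expect_indic//; last exact: measurable_double_cap.
  rewrite -expectZ//; last by apply: regular_indic; exact: measurable_double_cap.
  apply: le_expect => //.
  - apply: (@regularM _ _ (cst _)); first exact: regular_cst.
    by apply: regular_indic; exact: measurable_double_cap.
  - exact: regular_horner.
  move=> x Sx; have x01 := crd_sq_01 Sx.
  rewrite indicE; case: (boolP (x \in _)) => [/set_mem xa|_]; rewrite ?mulr1 ?mulr0.
    exact: step_poly_ge.
  by case/andP: (step_poly_01 n K x01).
have := int_upper n K; rewrite /g -(expect_poly muS muQ).
set E := expect _ in H *.
set r := Num.sqrt _ => H2.
have r0 : 0 < r by rewrite sqrtr_gt0 subr_gt0 expr_lt1// ltW.
have : E <= b ^+ s.+1 / (s.+1%:R * W * r) + e.
  rewrite -(ler_pM2r W0) (le_trans H2)// mulrDl lerD2r.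
  by rewrite [s.+1%:R * W * r]mulrAC [in leRHS](invfM _ W) mulrA divfK ?gt_eqF.
have em : e * m <= e by rewrite ler_piMr.
move: H em; rewrite mulrBl mul1r; set C := _ / _; set u := e * m => H em H3; rewrite -/e; lra.
Qed.

Lemma double_cap_ge_aux : a ^+ s.+1 / (s.+1%:R * W) <= fine (mu (double_cap b)).
Proof.
have [k K] := kexists.
set C := _ / _.
(* One [e] comes from the polynomial outside the double cap, and [C * e] from the factor [1 - e] of
   [int_lower]. *)
rewrite -subr_le0; apply: (le0_geometric eta01 (C := 1 + C)) => n.
set e := (a / b) ^+ n.
have W0 := @cossin_int0_gt0 R s.
have e01 : 0 <= e by rewrite exprn_ge0//; case/andP: eta01.
set m := fine _.
have H : expect (fun x => (step_poly a b k n).[crd ord0 x ^+ 2]) <= m + e.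
  rewrite /m -expect_indic//; last exact: measurable_double_cap.
  rewrite -[e in leRHS](@expect_cst _ _ _ muS) -expectD//; last 2 first.
  - by apply: regular_indic; exact: measurable_double_cap.
  - exact: regular_cst.
  apply: le_expect => //.
  - exact: regular_horner.
  - apply: regularD; last exact: regular_cst.
    by apply: regular_indic; exact: measurable_double_cap.
  move=> x Sx; have x01 := crd_sq_01 Sx.
  rewrite indicE; case: (boolP (x \in _)) => [_|].
    by apply: ler_wpDr => //; case/andP: (step_poly_01 n K x01).
  rewrite notin_setE/= => /negP; rewrite -ltNge => xb.
  by rewrite add0r; apply: step_poly_le => //; exact: ltW.
have := int_lower n K; rewrite /g -(expect_poly muS muQ).
set E := expect _ in H *; rewrite -/e => H2.
have : (1 - e) * C <= E.
  rewrite -(ler_pM2r W0) (le_trans _ H2)// -mulrA ler_wpM2l//.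
    by case/andP: eta01 => e0 e1; rewrite subr_ge0 exprn_ile1// ltW.
  by rewrite /C invfM mulrA divfK ?gt_eqF.
move: H; rewrite mulrBl mul1r mulrDl mul1r (mulrC C e); set eC := e * C => H H3; rewrite -/e; lra.
Qed.

End angles.
End tail.

Section tail.
Context {R : realType} (s : nat).
Local Notation T := (@bspace R s.+2).
Local Notation S := (@sphere R s.+1 : set T).
Variable mu : probability T R.
Hypothesis muS : mu S = 1%E.
Hypothesis muQ : forall Q : 'M[R]_s.+2, Q *m Q^T = 1%:M ->
  forall A : set T, measurable A -> mu [set x | A (Q *m x)] = mu A.

Local Notation expect := (@expect R s mu).
Local Notation crd k := (fun x : T => (x : 'cV[R]_s.+2) k ord0).
Local Notation W := (@cossin_int R 0 s).

Lemma double_cap_le (a : R) : 0 < a < 1 ->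
  fine (mu (double_cap a)) <= a ^+ s.+1 / (s.+1%:R * W * Num.sqrt (1 - a ^+ 2)).
Proof.
move=> /andP[a0 a1].
apply: (@right_limit_le R (fun b => b ^+ s.+1 / (s.+1%:R * W * Num.sqrt (1 - b ^+ 2))) a 1) => //.
  apply: cvgM; first exact: exprn_continuous.
  apply: cvgV.
    rewrite mulf_neq0 ?mulf_neq0 ?gt_eqF ?cossin_int0_gt0//.
    by rewrite sqrtr_gt0 subr_gt0 expr_lt1// ltW.
  apply: (@cvgM _ _ _ _ (cst _)); first exact: cvg_cst.
  apply: (@continuous_comp R R R (fun b => 1 - b ^+ 2) Num.sqrt); last exact: sqrt_continuous.
  by apply: cvgB; [exact: cvg_cst|exact: exprn_continuous].
by move=> b /andP[ab b1]; exact: double_cap_le_aux.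
Qed.

Lemma double_cap_ge (a : R) : 0 < a < 1 ->
  a ^+ s.+1 / (s.+1%:R * W) <= fine (mu (double_cap a)).
Proof.
move=> /andP[a0 a1].
apply: (@left_limit_ge R (fun b => b ^+ s.+1 / (s.+1%:R * W)) a 0) => //.
  by apply: cvgM; [exact: exprn_continuous|exact: cvg_cst].
by move=> b /andP[b0 ba]; exact: double_cap_ge_aux.
Qed.

Lemma measurable_dist (y : 'cV[R]_s.+2) (B : set R) : measurable B ->
  measurable [set x : T | B (enorm ((x : 'cV[R]_s.+2) - y))].
Proof.
move=> mB; have := @measurable_enormB R _ T _ id (cst (y : T)).
move=> /(_ (@measurable_id _ _ _) (@measurable_cst _ _ _ _ _ _)) m.
by rewrite -[X in measurable X]setTI; exact: m.
Qed.

(** Some reflection takes [y] to [z], and it preserves both the law and the distances. *)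
Lemma mu_dist_const (y z : 'cV[R]_s.+2) (B : set R) : S y -> S z -> measurable B ->
  mu [set x : T | B (enorm ((x : 'cV[R]_s.+2) - y))] =
  mu [set x : T | B (enorm ((x : 'cV[R]_s.+2) - z))].
Proof.
move=> /sphereE y1 /sphereE z1 mB.
have [Q [QT QQ Qy]] := reflection_exists y1 z1.
have QTQ : Q^T *m Q = 1%:M by rewrite QT.
rewrite -[RHS](muQ (Q := Q)) ?QT//; last exact: measurable_dist.
congr (mu _); apply/seteqP; split => x /=;
  by rewrite -Qy -mulmxBr !enormE dotv_orth.
Qed.

(** With the centre moved to [e_0], [|x - e_0| ^ 2 = 2 - 2 x_0] turns the cap into [x_0 >= c]. The
    antipodal cap has the same measure, and is disjoint from it because [c > 0] for [r <= 1]. *)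
Lemma mu_cap_half (y : 'cV[R]_s.+2) (r : R) : S y -> 0 < r <= 1 ->
  fine (mu [set x : T | enorm ((x : 'cV[R]_s.+2) - y) <= r]) =
  fine (mu (double_cap (Num.sqrt (1 - (1 - r ^+ 2 / 2) ^+ 2)))) / 2.
Proof.
move=> Sy /andP[r0 r1]; set c := 1 - r ^+ 2 / 2.
have c0 : 0 < c by rewrite /c; nra.
have c1 : c <= 1 by rewrite /c; nra.
have Se : S (@basis_vec R s ord0).
  by apply/sphereE; rewrite dotv_basis mxE !eqxx.
have mcrd : measurable_fun setT (fun x : T => crd ord0 x) by exact: measurable_coord.
have mB := measurable_set_le r.
pose Hp : set T := [set x | c <= crd ord0 x].
pose Hm : set T := [set x | crd ord0 x <= - c].
have mHp : measurable Hp.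
  rewrite (_ : Hp = (fun x : T => crd ord0 x) @^-1` `[c, +oo[).
    by rewrite -[X in measurable X]setTI; exact: mcrd.
  by apply/seteqP; split => x; rewrite /Hp/= in_itv/= andbT.
have mHm : measurable Hm.
  rewrite (_ : Hm = (fun x : T => crd ord0 x) @^-1` `]-oo, - c]).
    by rewrite -[X in measurable X]setTI; exact: mcrd.
  by apply/seteqP; split => x; rewrite /Hm/= in_itv.
have -> : mu [set x : T | enorm ((x : 'cV[R]_s.+2) - y) <= r] = mu Hp.
  rewrite (mu_dist_const (B := [set u | u <= r]) Sy Se)//.
  rewrite -(mu_setIsphere muS); last exact: (@measurable_dist _ [set u | u <= r]).
  rewrite -[RHS](mu_setIsphere muS)//; congr (mu _).
  have key (x : T) : S x -> (enorm ((x : 'cV[R]_s.+2) - @basis_vec R s ord0) <= r) = (c <= crd ord0 x).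
    move=> /sphereE x1; rewrite -(ler_pXn2r (n:=2)) ?nnegrE ?enorm_ge0 ?(ltW r0)//.
    rewrite sqr_enorm dotvBB (dotvC x) !dotv_basis mxE !eqxx/= x1 /c.
    by apply/idP/idP => H; lra.
  by apply/seteqP; split => x /= [H Sx]; split => //; move: H; rewrite /Hp/= key.
have -> : mu (double_cap (Num.sqrt (1 - c ^+ 2))) = (mu Hp + mu Hm)%E.
  rewrite -measureU//; last first.
    apply/seteqP; split => // x [] /=; rewrite /Hp /Hm /= => h1 h2.
    by have := lt_le_trans c0 (le_trans h1 h2); rewrite ltNge oppr_le0 (ltW c0).
  congr (mu _); apply/seteqP; rewrite /double_cap sqr_sqrtr; last by nra.
  split => x /=; rewrite /Hp /Hm /=; set u := (x : 'cV_s.+2) _ _.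
    move=> H; case: (leP c u) => [|uc]; first by left.
    right; nra.
  by case=> H; nra.
have -> : mu Hm = mu Hp.
  rewrite -(muQ (Q := - 1%:M)) ?linearN/= ?mulNmx ?mulmxN ?opprK ?mul1mx ?trmx1//.
  by congr (mu _); apply/seteqP; split => x; rewrite /Hp /Hm /= mulNmx mul1mx mxE => H; lra.
rewrite fineD ?fin_num_measure//.
set v := fine _; lra.
Qed.

Lemma psi_gt0 : 0 < psi R s.+1.
Proof. by rewrite psi_cossin_int !mulr_gt0// cossin_int0_gt0. Qed.

(** The half-chord parameter [a] satisfies [a ^ 2 = r ^ 2 (1 - r ^ 2 / 4)], hence lies between
    [r (1 - r ^ 2 / 4)] and [r], and [sqrt (1 - a ^ 2) = 1 - r ^ 2 / 2]. Halving the double cap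
    turns the denominator [t W] into [2 t W = psi t]. *)
Lemma cap_bounds (y : 'cV[R]_s.+2) (r : R) : S y -> 0 < r <= 1 ->
  r ^+ s.+1 * (1 - r ^+ 2 / 4) ^+ s.+1 / psi R s.+1 <=
    fine (mu [set x : T | enorm ((x : 'cV[R]_s.+2) - y) <= r]) <=
  r ^+ s.+1 / (psi R s.+1 * (1 - r ^+ 2 / 2)).
Proof.
move=> Sy r01; rewrite mu_cap_half//; have /andP[r0 r1] := r01.
set c := 1 - r ^+ 2 / 2; set a := Num.sqrt (1 - c ^+ 2).
have c0 : 0 < c by rewrite /c; nra.
have q0 : 0 < r ^+ 2 by rewrite exprn_gt0.
have q1 : r ^+ 2 <= 1 by rewrite exprn_ile1// ltW.
have c2 : 1 - c ^+ 2 = r ^+ 2 * (1 - r ^+ 2 / 4) by rewrite /c; field.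
have rr : 0 < 1 - r ^+ 2 / 4 <= 1 by apply/andP; split; lra.
have c20 : 0 < 1 - c ^+ 2 by rewrite c2 mulr_gt0//; case/andP: rr.
have a2 : a ^+ 2 = r ^+ 2 * (1 - r ^+ 2 / 4) by rewrite sqr_sqrtr// ltW.
have a0 : 0 < a by rewrite sqrtr_gt0.
have [rr0 rr1] : 0 < 1 - r ^+ 2 / 4 /\ 1 - r ^+ 2 / 4 <= 1 by case/andP: rr.
have rz0 : 0 < r * (1 - r ^+ 2 / 4) by rewrite mulr_gt0.
have ar : a <= r.
  by rewrite -ler_sqr ?nnegrE ?(ltW a0) ?(ltW r0)// a2 ger_pMr.
have ra : r * (1 - r ^+ 2 / 4) <= a.
  rewrite -ler_sqr ?nnegrE ?(ltW a0) ?(ltW rz0)// a2 exprMn ler_pM2l// expr2.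
  by rewrite ger_pMr.
have a1 : a < 1.
  by rewrite -ltr_sqr ?nnegrE ?(ltW a0)// expr1n -subr_gt0 a2 -c2 opprB addrC subrK exprn_gt0.
have a01 : 0 < a < 1 by rewrite a0.
have W0 := @cossin_int0_gt0 R s.
have sa : Num.sqrt (1 - a ^+ 2) = c.
  rewrite (_ : 1 - a ^+ 2 = c ^+ 2); last by rewrite a2 /c; field.
  by rewrite sqrtr_sqr ger0_norm// ltW.
have tW : 0 < s.+1%:R * W by rewrite mulr_gt0.
have := double_cap_le a01; have := double_cap_ge a01; rewrite sa psi_cossin_int -[2 * _ * _]mulrA.
set w := s.+1%:R * W in tW *; set m := fine _ => H1 H2; apply/andP; split.
  rewrite -exprMn ler_pdivrMr ?mulr_gt0//.
  rewrite (_ : m / 2 * (2 * w) = m * w); last by field.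
  rewrite ler_pdivrMr// in H1; apply: le_trans H1.
  by rewrite lerXn2r ?nnegrE ?(ltW rz0) ?(ltW a0).
rewrite ler_pdivlMr ?mulr_gt0//.
rewrite (_ : m / 2 * (2 * w * c) = m * (w * c)); last by field.
rewrite ler_pdivlMr ?mulr_gt0// in H2; apply: (le_trans H2).
by rewrite lerXn2r ?nnegrE ?(ltW r0) ?(ltW a0).
Qed.

End tail.

(** * Independence and isolated vertices *)

Section prob_xsection.
Local Open Scope ereal_scope.
Context {R : realType} d1 d (T : measurableType d1) (Om : measurableType d).
Variables (P : probability Om R) (Y : Om -> T).
Hypothesis mY : measurable_fun setT Y.
Variable C : set (set Om).
Hypotheses (CI : setI_closed C) (CT : C setT) (Cm : C `<=` measurable).
Hypothesis ind : forall B A, measurable B -> C A ->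
  P (Y @^-1` B `&` A) = P (Y @^-1` B) * P A.

(** [Y] is itself a function on [Om], so it is independent of the events of [C] only; hence the
    restriction on the second factor. *)
Definition indep_rectangles : set (set (T * Om)) :=
  [set E | exists B A, [/\ measurable B, C A & E = B `*` A]].

(* Both sides are measures of [E]: the law of [(Y, id)] and the product of the
   law of [Y] with [P]; they agree on the pi-system [indep_rectangles]. *)
Lemma prob_xsection (E : set (T * Om)) : <<s indep_rectangles >> E ->
  P [set w | E (Y w, w)] = \int[P]_w P (xsection E (Y w)).
Proof.
move=> sE; pose h w := (Y w, w).
have mh : measurable_fun setT h by apply/measurable_fun_pair.
have fm : indep_rectangles `<=` measurable.
  by move=> _ [B [A [mB CA ->]]]; apply: measurableX => //; exact: Cm.
have mE : measurable E by apply: (smallest_sub _ fm) sE; exact: sigma_algebra_measurable.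
pose nu := pushforward P Y.
transitivity ((nu \x P) E); last first.
  rewrite /product_measure1 /nu ge0_integral_pushforward//.
  exact: measurable_fun_xsection.
apply/esym.
apply: (@g_sigma_algebra_measure_unique _ R _ indep_rectangles fm (fun=> setT) _ _ (nu \x P) (pushforward P h)) => //.
- by move=> _; exists setT, setT; rewrite setXTT.
- by apply/seteqP; split => // x _; exists 0%N.
- move=> _ _ [B [A [mB CA ->]]] [B' [A' [mB' CA' ->]]].
  exists (B `&` B'), (A `&` A'); split; [exact: measurableI|exact: CI|].
  by rewrite setXI.
- move=> _ [B [A [mB CA ->]]]; rewrite [LHS]product_measure1E//; last exact: Cm.
  rewrite -ind//; congr (P _).
- move=> _; rewrite -setXTT [ltLHS]product_measure1E//.
  rewrite /= /nu /pushforward /= preimage_setT.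
  by rewrite probability_setT mule1 ltry.
Qed.

Variables (S : set T).
Hypotheses (mS : measurable S) (YS : P (Y @^-1` S) = 1).

Let nY : P (~` (Y @^-1` S)) = 0.
Proof.
rewrite probability_setC//; first by rewrite YS subee.
by rewrite -[X in measurable X]setTI; exact: mY.
Qed.

Let mYS : measurable (Y @^-1` S).
Proof. by rewrite -[X in measurable X]setTI; exact: mY. Qed.

Let mx (E : set (T * Om)) : <<s indep_rectangles >> E ->
  measurable_fun setT (fun w => P (xsection E (Y w))).
Proof.
move=> sE; have fm : indep_rectangles `<=` measurable.
  by move=> _ [B [A [mB CA ->]]]; apply: measurableX => //; exact: Cm.
have mE : measurable E by apply: (smallest_sub _ fm) sE; exact: sigma_algebra_measurable.
exact: (measurableT_comp (measurable_fun_xsection P mE) mY).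
Qed.

Let integral_YS (f : Om -> \bar R) : measurable_fun setT f -> (forall x, 0 <= f x) ->
  \int[P]_w f w = \int[P]_(w in Y @^-1` S) f w.
Proof.
move=> mf f0; rewrite -[X in \int[_]_(_ in X) _](setUv (Y @^-1` S)).
rewrite ge0_integral_setU//; last 3 first.
- exact: measurableC.
- by rewrite setUv.
- by apply/disj_setPS => x [].
rewrite [X in _ + X](_ : _ = 0) ?adde0//.
apply: null_set_integral => //; [exact: measurableC|exact: measurable_funTS].
Qed.

Lemma prob_xsection_const (E : set (T * Om)) (c : \bar R) : <<s indep_rectangles >> E -> c \is a fin_num ->
  (forall x, S x -> P (xsection E x) = c) -> P [set w | E (Y w, w)] = c.
Proof.
move=> sE fc Ec; rewrite prob_xsection// integral_YS//; last exact: mx.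
rewrite (eq_integral (cst c)); last by move=> w /set_mem /= Sw; exact: Ec.
by rewrite integral_cst//= YS mule1.
Qed.

(** The indicator allows a worse bound on an exceptional set [B]: in the second moment, the
    positions close to a vertex already fixed. *)
Lemma prob_xsection_le (E : set (T * Om)) (B : set T) (c1 c2 : R) : <<s indep_rectangles >> E ->
  measurable B -> (0 <= c1)%R -> (0 <= c2)%R ->
  (forall x, S x -> P (xsection E x) <= (c1 + c2 * \1_B x)%:E) ->
  P [set w | E (Y w, w)] <= c1%:E + c2%:E * P (Y @^-1` B).
Proof.
move=> sE mB c10 c20 Ec; rewrite prob_xsection// integral_YS//; last exact: mx.
have mYB : measurable (Y @^-1` B) by rewrite -[X in measurable X]setTI; exact: mY.
have m2 : measurable_fun setT (fun w => c1%:E + c2%:E * (\1_(Y @^-1` B) w)%:E).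
  apply: emeasurable_funD => //; apply: emeasurable_funM => //.
  by apply/measurable_EFinP; exact: measurable_indic.
have p2 w : 0 <= c1%:E + c2%:E * (\1_(Y @^-1` B) w)%:E.
  by rewrite -EFinM -EFinD lee_fin addr_ge0 ?mulr_ge0.
apply: (@le_trans _ _ (\int[P]_(w in Y @^-1` S) (c1%:E + c2%:E * (\1_(Y @^-1` B) w)%:E))).
  apply: ge0_le_integral => //.
  - by apply: measurable_funTS; exact: mx.
  - exact: measurable_funTS.
  - by move=> w Sw; apply: le_trans (Ec _ Sw) _; rewrite EFinD EFinM !indicE.
rewrite -(@integral_YS (fun w => c1%:E + c2%:E * (\1_(Y @^-1` B) w)%:E))// ge0_integralD//; last 2 first.
- by move=> x _; rewrite -EFinM lee_fin mulr_ge0.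
- apply: emeasurable_funM => //.
  by apply/measurable_EFinP; exact: measurable_indic.
rewrite integral_cst//= probability_setT mule1 leeD2l//.
rewrite ge0_integralZl_EFin//; last by apply/measurable_EFinP; exact: measurable_indic.
by rewrite integral_indic// setIT.
Qed.

End prob_xsection.

Section law.
Context {R : realType} d (Om : measurableType d) d1 (T : measurableType d1)
  (P : probability Om R) (Y : Om -> T).
Hypothesis mY : measurable_fun setT Y.
HB.instance Definition _ := isMeasurableFun.Build _ _ _ _ Y mY.
Definition law : probability T R := distribution P Y.
End law.

Section graph.
Local Open Scope ereal_scope.
Context {R : realType} (s : nat) d (Om : measurableType d) (P : probability Om R) (n : nat).
Local Notation T := (@bspace R s.+2).
Local Notation S := (@sphere R s.+1 : set T).
Variable X : 'I_n -> Om -> T.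
Hypothesis hX : @iid_uniform_on_sphere R d Om P n s.+1 X.

Lemma iid_measurable i : measurable_fun setT (X i).
Proof. by case: hX => rX _ _ _ A mA; rewrite setTI; exact: (rX i). Qed.

Local Notation mX := iid_measurable.

Lemma iid_sphere i : P (X i @^-1` S) = 1.
Proof. by case: hX => _ uX _; have [] := uX i. Qed.

Lemma iid_preimage_measurable i A : measurable A -> measurable (X i @^-1` A).
Proof. by move=> mA; rewrite -[X in measurable X]setTI; exact: mX. Qed.

Lemma iid_dist_const i (x y : 'cV[R]_s.+2) (B : set R) : S x -> S y -> measurable B ->
  P [set w | B (enorm ((X i w : 'cV[R]_s.+2) - x))] =
  P [set w | B (enorm ((X i w : 'cV[R]_s.+2) - y))].
Proof.
have [_ uX _] := hX; have [u1 uQ] := uX i.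
move=> Sx Sy mB; exact: (@mu_dist_const R s (law P (mX i)) uQ x y B).
Qed.

Lemma iid_cap_bounds i (x : 'cV[R]_s.+2) (r : R) : S x -> (0 < r <= 1)%R ->
  (r ^+ s.+1 * (1 - r ^+ 2 / 4) ^+ s.+1 / psi R s.+1 <=
    fine (P [set w | (enorm ((X i w : 'cV[R]_s.+2) - x) <= r)%R]) <=
  r ^+ s.+1 / (psi R s.+1 * (1 - r ^+ 2 / 2)))%R.
Proof.
have [_ uX _] := hX; have [u1 uQ] := uX i.
by move=> Sx r01; exact: (@cap_bounds R s (law P (mX i)) u1 uQ x r).
Qed.

(** Product events of the vertices outside [K]: a pi-system that is independent of each vertex of
    [K] by the product rule. *)
Definition cylinders (K : {set 'I_n}) : set (set Om) :=
  [set A | exists A_ : 'I_n -> set T, (forall j, measurable (A_ j)) /\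
     A = \bigcap_(j in [set` ~: K]) (X j @^-1` A_ j)].

Lemma cylindersI K : setI_closed (cylinders K).
Proof.
move=> _ _ [A [mA ->]] [B [mB ->]]; exists (fun j => A j `&` B j); split.
  by move=> j; exact: measurableI.
by rewrite -bigcapI; apply: eq_bigcapr => j _; rewrite preimage_setI.
Qed.

Lemma cylindersT K : cylinders K setT.
Proof.
exists (fun=> setT); split=> //.
by apply/seteqP; split.
Qed.

Lemma cylinders_measurable K : cylinders K `<=` measurable.
Proof.
move=> _ [A [mA ->]]; apply: fin_bigcap_measurable; first exact: finite_finset.
by move=> j _; exact: iid_preimage_measurable.
Qed.

Lemma iid_prod (J : {set 'I_n}) (A : 'I_n -> set T) : (forall j, measurable (A j)) ->
  P (\bigcap_(j in [set` J]) (X j @^-1` A j)) = \prod_(j in J) P (X j @^-1` A j).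
Proof. by case: hX => _ _ iX mA; exact: iX. Qed.

Lemma cylinders_ind (K : {set 'I_n}) i B A : i \in K -> measurable B -> cylinders K A ->
  P (X i @^-1` B `&` A) = P (X i @^-1` B) * P A.
Proof.
move=> iK mB [A_ [mA ->]].
(* The slot [i] is free since [i] lies in [K]; filling it with [B] gives a single product event. *)
pose A' j := if j == i then B else A_ j.
have mA' j : measurable (A' j) by rewrite /A'; case: ifP.
have iCK : i \notin ~: K by rewrite inE negbK.
have A'i j : j \in ~: K -> A' j = A_ j.
  by rewrite /A'; case: eqP => // ->; rewrite (negbTE iCK).
have -> : X i @^-1` B `&` \bigcap_(j in [set` ~: K]) (X j @^-1` A_ j) =
    \bigcap_(j in [set` i |: ~: K]) (X j @^-1` A' j).
  apply/seteqP; split => w.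
    move=> [Bw Aw] j /=; rewrite !inE => /orP[/eqP->|jK].
      by rewrite /A' eqxx.
    rewrite A'i ?inE//; apply: Aw; by rewrite /= inE.
  move=> Aw; split.
    by have := Aw i; rewrite /= setU11 /A' eqxx; apply.
  move=> j /= jK; have := Aw j; rewrite /= setU1r// => /(_ isT).
  by rewrite A'i.
rewrite !iid_prod// big_setU1//= /A' eqxx; congr (_ * _).
by apply: eq_bigr => j /A'i; rewrite /A' => ->.
Qed.

(** Measurability on this space is the membership that [prob_xsection] requires; it is obtained by
    composing measurable maps rather than by exhibiting rectangles. *)
Definition cond_space (K : {set 'I_n}) : measurableType _ :=
  g_sigma_algebraType (indep_rectangles (T := T) (cylinders K)).

Lemma measurable_cond_fst K : measurable_fun setT (fun z : cond_space K => (z : T * Om).1 : T).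
Proof.
move=> _ B mB; rewrite setTI; apply: sub_sigma_algebra.
exists B, setT; split => //; first exact: cylindersT.
by apply/seteqP; split => // -[x w] [].
Qed.

Lemma measurable_cond_snd (K : {set 'I_n}) j : j \notin K ->
  measurable_fun setT (fun z : cond_space K => X j (z : T * Om).2).
Proof.
move=> jK _ B mB; rewrite setTI; apply: sub_sigma_algebra.
exists setT, (X j @^-1` B); split => //; last by apply/seteqP; split => // -[x w] [].
exists (fun i => if i == j then B else setT); split; first by move=> i; case: ifP.
apply/seteqP; split => w.
  by move=> Bw i _ /=; case: eqP => [->|].
by move=> /(_ j); rewrite /= inE eqxx; exact.
Qed.

(** This stands in for the uniqueness of the invariant law. Fixing the other vertex shows that each
    side is the probability that [|X_i - X_j|] lies in [B], which is symmetric in [i] and [j]. *)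
Lemma iid_dist_eq i j (x : 'cV[R]_s.+2) (B : set R) : S x -> measurable B ->
  P [set w | B (enorm ((X i w : 'cV[R]_s.+2) - x))] =
  P [set w | B (enorm ((X j w : 'cV[R]_s.+2) - x))].
Proof.
have [->//|ij] := eqVneq i j; move=> Sx mB.
have aux k l : k != l ->
    P [set w | B (enorm ((X k w : 'cV[R]_s.+2) - x))] =
    P [set w | B (enorm ((X k w : 'cV[R]_s.+2) - (X l w : 'cV[R]_s.+2)))].
  move=> kl; apply/esym.
  pose E : set (T * Om) := [set z | B (enorm ((X k z.2 : 'cV[R]_s.+2) - (z.1 : 'cV[R]_s.+2)))].
  have sE : <<s indep_rectangles (T := T) (cylinders [set l]%SET) >> E.
    have kK : k \notin [set l]%SET by rewrite inE.
    have := measurable_enormB (measurable_cond_snd kK) (@measurable_cond_fst [set l]%SET).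
    by move=> /(_ measurableT B mB); rewrite setTI.
  apply: (@prob_xsection_const _ _ _ _ _ P (X l) (mX l) (cylinders [set l]%SET) (@cylindersI _)
    (@cylindersT _) (@cylinders_measurable _) _ S _ (iid_sphere l) E _ sE).
  - by move=> *; apply: (@cylinders_ind [set l]%SET) => //; rewrite inE.
  - exact: measurable_sphere.
  - by rewrite fin_num_measure//; exact: (iid_preimage_measurable k (@measurable_dist R s x B mB)).
  - move=> y Sy; rewrite (_ : xsection E y = [set w | B (enorm ((X k w : 'cV[R]_s.+2) - y))]).
      exact: iid_dist_const.
    by apply/seteqP; split => w; rewrite /xsection/= inE.
rewrite (aux i j)// (aux j i) 1?eq_sym//.
by congr (P _); apply/seteqP; split => w /=; rewrite enorm_distC.
Qed.

End graph.

Section isolated.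
Local Open Scope ereal_scope.
Context {R : realType} (s : nat) d (Om : measurableType d) (P : probability Om R) (n : nat).
Local Notation T := (@bspace R s.+2).
Local Notation S := (@sphere R s.+1 : set T).
Variable X : 'I_n -> Om -> T.
Hypothesis hX : @iid_uniform_on_sphere R d Om P n s.+1 X.
Variables (r1 r2 p q : R).

Definition farset (x : T) : set T :=
  [set y | ~~ (r1 <= enorm ((y : 'cV[R]_s.+2) - (x : 'cV[R]_s.+2)) <= r2)%R].

Hypothesis hp : forall j (x : T), S x -> P (X j @^-1` farset x) = (1 - p)%:E.
Hypothesis hq : forall j (x : T), S x ->
  P [set w | (enorm ((X j w : 'cV[R]_s.+2) - (x : 'cV[R]_s.+2)) <= 2 * r2)%R] <= q%:E.
Hypotheses (p0 : (0 <= p)%R) (p12 : (2 * p <= 1)%R).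

Definition isolated_at (i : 'I_n) : set Om :=
  [set w | [forall j, ~~ rag r1 r2 (X ^~ w) i j]].

Lemma isolated_atE i : isolated_at i =
  [set w | forall j, j != i -> farset (X i w) (X j w)].
Proof.
apply/seteqP; split => w /=.
  move=> /forallP H j ji; have := H j; rewrite /rag eq_sym ji/=.
  by rewrite /farset/= enorm_distC.
move=> H; apply/forallP => j; rewrite /rag; case: eqVneq => //= ij.
by have := H j; rewrite eq_sym ij => /(_ isT); rewrite /farset/= enorm_distC.
Qed.

Lemma measurable_far d' (U : measurableType d') (f g : U -> T) :
  measurable_fun setT f -> measurable_fun setT g -> measurable [set z | farset (f z) (g z)].
Proof.
move=> mf mg; have m := measurable_enormB mg mf.
rewrite (_ : [set z | _] = ~` [set z | (enorm ((g z : 'cV[R]_s.+2) - (f z : 'cV[R]_s.+2))) \in `[r1, r2] ]).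
  apply: measurableC; have := m measurableT `[r1, r2]%classic (measurable_itv _).
  by rewrite setTI.
by apply/seteqP; split => z; rewrite /farset/= in_itv/= => /negP.
Qed.

Lemma measurable_farset x : measurable (farset x).
Proof. exact: (@measurable_far _ T (cst x) id (@measurable_cst _ _ _ _ _ _) (@measurable_id _ _ _)). Qed.

Lemma measurable_isolated_at i : measurable (isolated_at i).
Proof.
rewrite isolated_atE (_ : [set w | _] =
  \bigcap_(j in [set` ~: [set i]%SET]) [set w | farset (X i w) (X j w)]).
  apply: fin_bigcap_measurable; first exact: finite_finset.
  by move=> j _; apply: measurable_far; exact: (iid_measurable hX).
apply/seteqP; split => w /= H j; first by rewrite /= !inE => ji; exact: H.
by move=> ji; apply: H; rewrite /= !inE.
Qed.

Lemma P_isolated_at i : P (isolated_at i) = ((1 - p) ^+ n.-1)%:E.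
Proof.
pose K : {set 'I_n} := [set i]%SET.
pose E : set (T * Om) := \bigcap_(j in [set` ~: K]) [set z | farset z.1 (X j z.2)].
have iK : i \in K by rewrite inE.
have sE : <<s indep_rectangles (T := T) (cylinders X K) >> E.
  have m : @measurable _ (cond_space X K) E.
    apply: fin_bigcap_measurable; first exact: finite_finset.
    move=> j /=; rewrite inE => jK.
    exact: (measurable_far (@measurable_cond_fst _ _ _ _ _ X K) (measurable_cond_snd (X := X) jK)).
  exact: m.
rewrite isolated_atE (_ : [set w | _] = [set w | E (X i w, w)]); last first.
  apply/seteqP; split => w /= H j; first by rewrite /= !inE => ji; exact: H.
  by move=> ji; apply: H; rewrite /= !inE.
apply: (@prob_xsection_const _ _ _ _ _ P (X i) (iid_measurable hX i) (cylinders X K) (@cylindersI _ _ _ _ _ _ K)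
    (@cylindersT _ _ _ _ _ _ K) (cylinders_measurable hX (K := K)) _ S _ (iid_sphere hX i) E _ sE) => //.
- by move=> *; apply: (cylinders_ind hX iK).
- exact: measurable_sphere.
- move=> x Sx.
  rewrite (_ : xsection E x = \bigcap_(j in [set` ~: K]) (X j @^-1` farset x)); last first.
    by apply/seteqP; split => w; rewrite /xsection/= inE.
  rewrite (iid_prod hX); last by move=> j; exact: measurable_farset.
  under eq_bigr do rewrite hp//.
  by rewrite prodEFin prodr_const cardsC1 card_ord.
Qed.

(** Vertices [i] and [k] are fixed in turn, and only the other [n - 2] are tested. If the two
    positions are more than [2 * r2] apart, a vertex avoids both annuli with probability
    [1 - 2 * p]; otherwise, an event of probability at most [q], a single annulus is taken into
    account. *)
Lemma P_two_isolated i k : i != k ->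
  P (isolated_at i `&` isolated_at k) <=
  ((1 - 2 * p) ^+ n.-2 + (1 - p) ^+ n.-2 * q)%:E.
Proof.
move=> ik.
pose K : {set 'I_n} := [set i]%SET; pose L : {set 'I_n} := [set i; k]%SET.
have iK : i \in K by rewrite inE.
have kK : k \notin K by rewrite inE eq_sym.
have kL : k \in L by rewrite !inE eqxx orbT.
have u0 : (0 <= (1 - 2 * p) ^+ n.-2)%R by rewrite exprn_ge0// subr_ge0.
have v0 : (0 <= (1 - p) ^+ n.-2)%R.
  by rewrite exprn_ge0// subr_ge0 (le_trans _ p12)// mulr_natl mulr2n lerDl.
pose E : set (T * Om) := \bigcap_(j in [set` ~: L])
  [set z | farset z.1 (X j z.2) /\ farset (X k z.2) (X j z.2)].
have sE : <<s indep_rectangles (T := T) (cylinders X K) >> E.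
  have m : @measurable _ (cond_space X K) E.
    apply: fin_bigcap_measurable; first exact: finite_finset.
    move=> j /=; rewrite !inE negb_or => /andP[ji jk].
    have jK : j \notin K by rewrite inE.
    apply: measurableI.
      exact: (measurable_far (@measurable_cond_fst _ _ _ _ _ X K) (measurable_cond_snd (X := X) jK)).
    exact: (measurable_far (measurable_cond_snd (X := X) kK) (measurable_cond_snd (X := X) jK)).
  exact: m.
have fm : indep_rectangles (T := T) (cylinders X K) `<=` measurable.
  by move=> _ [B [A [mB CA ->]]]; apply: measurableX => //; exact: (cylinders_measurable hX CA).
have mE : measurable E by apply: (smallest_sub _ fm) sE; exact: sigma_algebra_measurable.
apply: (@le_trans _ _ (P [set w | E (X i w, w)])).
  apply: le_measure; rewrite ?inE.
  - by apply: measurableI; exact: measurable_isolated_at.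
  - have mh : measurable_fun setT (fun w => (X i w, w)).
      by apply/measurable_fun_pair => //; exact: (iid_measurable hX).
    by rewrite -[X in measurable X]setTI; exact: mh.
  - rewrite !isolated_atE => w [Hi Hk] j /=; rewrite !inE negb_or => /andP[ji jk].
    by split; [exact: Hi|exact: Hk].
set c := (_ + _)%R.
have q0 : (0 <= q)%R.
  have Se : S (@basis_vec R s ord0).
    by apply/sphereE; rewrite dotv_basis mxE !eqxx.
  by have := le_trans (measure_ge0 _ _) (hq i Se); rewrite lee_fin.
have c0 : (0 <= c)%R by rewrite addr_ge0// mulr_ge0.
(* The bound [c] is uniform in the position of [i], so the exceptional set is empty at this
   stage. *)
have := @prob_xsection_le _ _ _ _ _ P (X i) (iid_measurable hX i) (cylinders X K) (@cylindersI _ _ _ _ _ _ K)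
    (@cylindersT _ _ _ _ _ _ K) (cylinders_measurable hX (K := K)) _ S _ (iid_sphere hX i) E set0 c 0%R.
rewrite mul0e adde0; apply => //.
- by move=> *; apply: (cylinders_ind hX iK).
- exact: measurable_sphere.
move=> x Sx; rewrite mul0r addr0.
pose F : set (T * Om) := \bigcap_(j in [set` ~: L])
  [set z | farset x (X j z.2) /\ farset z.1 (X j z.2)].
have -> : xsection E x = [set w | F (X k w, w)].
  by apply/seteqP; split => w; rewrite /xsection/= inE.
have sF : <<s indep_rectangles (T := T) (cylinders X L) >> F.
  have m : @measurable _ (cond_space X L) F.
    apply: fin_bigcap_measurable; first exact: finite_finset.
    move=> j /=; rewrite inE => jL.
    apply: measurableI.
      exact: (measurable_far (@measurable_cst _ _ _ _ _ x) (measurable_cond_snd (X := X) jL)).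
    exact: (measurable_far (@measurable_cond_fst _ _ _ _ _ X L) (measurable_cond_snd (X := X) jL)).
  exact: m.
pose B : set T := [set y | (enorm ((y : 'cV[R]_s.+2) - (x : 'cV[R]_s.+2)) <= 2 * r2)%R].
have mB : measurable B.
  exact: (@measurable_dist R s x [set u | (u <= 2 * r2)%R] (measurable_set_le _)).
have := @prob_xsection_le _ _ _ _ _ P (X k) (iid_measurable hX k) (cylinders X L) (@cylindersI _ _ _ _ _ _ L)
    (@cylindersT _ _ _ _ _ _ L) (cylinders_measurable hX (K := L)) _ S _ (iid_sphere hX k) F B
    ((1 - 2 * p) ^+ n.-2)%R ((1 - p) ^+ n.-2)%R.
move=> H; apply: le_trans (H _ _ _ _ _ _ _) _ => //.
- by move=> *; apply: (cylinders_ind hX kL).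
- exact: measurable_sphere.
- move=> y Sy.
  rewrite (_ : xsection F y = \bigcap_(j in [set` ~: L]) (X j @^-1` (farset x `&` farset y))); last first.
    by apply/seteqP; split => w; rewrite /xsection/= inE.
  have mxy : measurable (farset x `&` farset y) by apply: measurableI; exact: measurable_farset.
  rewrite (iid_prod hX)//.
  have cL : #|~: L| = n.-2.
    have H2 : (2 + #|~: L| = n)%N by have := cardsC L; rewrite cards2 ik card_ord.
    by rewrite -(addKn 2 #|~: L|) H2 subn2.
  have prod_le (c' : R) : (forall j, P (X j @^-1` (farset x `&` farset y)) <= c'%:E) ->
      \prod_(j in ~: L) P (X j @^-1` (farset x `&` farset y)) <= (c' ^+ n.-2)%:E.
    move=> Hc; have fP j : P (X j @^-1` (farset x `&` farset y)) \is a fin_num.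
      by rewrite fin_num_measure//; exact: (iid_preimage_measurable hX).
    under eq_bigr do rewrite -(fineK (fP _)).
    rewrite prodEFin lee_fin -cL -prodr_const; apply: ler_prod => j _.
    by rewrite fine_ge0//= -lee_fin fineK.
  rewrite indicE; case: (boolP (y \in B)) => [yB|yB]; rewrite ?mulr1 ?mulr0 ?addr0.
    apply: (@le_trans _ _ ((1 - p) ^+ n.-2)%:E); last by rewrite lee_fin lerDr.
    apply: prod_le => j; rewrite -(hp j Sx); apply: le_measure; rewrite ?inE.
    + exact: (iid_preimage_measurable hX).
    + by apply: (iid_preimage_measurable hX); exact: measurable_farset.
    + by move=> w [].
  apply: prod_le => j; rewrite preimage_setI.
  have mx := iid_preimage_measurable hX j (measurable_farset x).
  have my := iid_preimage_measurable hX j (measurable_farset y).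
  have := measureDI P mx my.
  (* A point in the annuli of both [x] and [y] would put [y] within [2 * r2] of [x], so missing
     [farset y] forces membership in [farset x]. *)
  have -> : X j @^-1` farset x `\` X j @^-1` farset y = ~` (X j @^-1` farset y).
    apply/seteqP; split => w; first by case.
    move=> H2; split => //; apply/negP => H1; move/negP : H2; rewrite negbK => /andP[_ h2].
    move/andP : H1 => [_ h1]; move/negP : yB; apply; apply/mem_set; rewrite /B/=.
    have -> : ((y : 'cV[R]_s.+2) - x = (y - X j w) + (X j w - x))%R.
      by rewrite addrA subrK.
    apply: (le_trans (enormD _ _)); rewrite mulr_natl mulr2n lerD//.
    by rewrite enorm_distC.
  have fP : P (X j @^-1` farset x `&` X j @^-1` farset y) \is a fin_num.
    by rewrite fin_num_measure//; exact: measurableI.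
  rewrite /= probability_setC// !hp// -(fineK fP) -EFinB -EFinD => -[H2].
  rewrite lee_fin; lra.
- by rewrite EFinD EFinM leeD2l// lee_wpmul2l// hq.
Qed.

End isolated.

(** * First and second moment bounds for finitely many events *)

Section count.
Local Open Scope ereal_scope.
Context {R : realType} d (Om : measurableType d) (P : probability Om R) (n : nat).
Variable A : 'I_n -> set Om.
Hypothesis mA : forall i, measurable (A i).

Definition none_of : set Om := [set w | forall i, ~ A i w].

Lemma none_ofE : none_of = ~` (\bigcup_(i in [set: 'I_n]) A i).
Proof.
apply/seteqP; split => w H; first by case=> i _; exact: H.
by move=> i Aw; apply: H; exists i.
Qed.

Lemma measurable_none_of : measurable none_of.
Proof.
rewrite none_ofE; apply: measurableC; exact: fin_bigcup_measurable.
Qed.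

Let mi (B : set Om) : measurable B -> measurable_fun setT (fun w => (\1_B w)%:E : \bar R).
Proof. by move=> mB; apply/measurable_EFinP; exact: measurable_indic. Qed.

Let i0 (B : set Om) w : 0 <= (\1_B w : R)%:E.
Proof. by rewrite lee_fin. Qed.

Let IB (B : set Om) : measurable B -> \int[P]_w (\1_B w : R)%:E = P B.
Proof. by move=> mB; rewrite integral_indic// setIT. Qed.

Let mN := measurable_none_of.

(** Union bound, obtained by integrating the pointwise inequality [1 <= 1_none + sum_i 1_(A i)]. *)
Lemma none_of_ge (c : R) : (forall i, P (A i) = c%:E) ->
  (1 - n%:R * c)%:E <= P none_of.
Proof.
move=> Ac.
have fN : P none_of \is a fin_num by rewrite fin_num_measure.
suff : 1 <= P none_of + \sum_i P (A i).
  under eq_bigr do rewrite Ac.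
  rewrite sumEFin sumr_const card_ord -(mulr_natl c n) -(fineK fN) -EFinD !lee_fin.
  by rewrite lerBlDr.
rewrite (_ : P none_of + _ = \int[P]_w ((\1_none_of w)%:E + \sum_i (\1_(A i) w)%:E)); last first.
  rewrite ge0_integralD//; last 3 first.
  - exact: mi.
  - by move=> w _; rewrite sume_ge0.
  - by apply: emeasurable_sum => i; exact: mi.
  rewrite IB// ge0_integral_sum//; last by move=> i; exact: mi.
  by congr (_ + _); apply: eq_bigr => i _; rewrite IB.
rewrite -[leLHS](@probability_setT _ _ _ P) -[leLHS]mul1e -integral_cst//.
apply: ge0_le_integral => //.
- by apply: emeasurable_funD; [exact: mi|apply: emeasurable_sum => i; exact: mi].
- move=> w _; rewrite indicE; case: (boolP (w \in none_of)) => [_|].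
    by rewrite leeDl// sume_ge0.
  rewrite notin_setE none_ofE => /contrapT[i _ Aw].
  rewrite (bigD1 i)//= indicE mem_set// add0e leeDl// sume_ge0//.
Qed.

(* Chebyshev's inequality for the number of events that occur, in the form
   [m ^ 2 1_(W = 0) + 2 m W <= W ^ 2 + m ^ 2]. *)
Lemma none_of_le (c u : R) : (0 < n)%N -> (0 < c)%R -> (forall i, P (A i) = c%:E) ->
  (forall i k, i != k -> P (A i `&` A k) <= u%:E) -> (0 <= u)%R ->
  P none_of <= ((n%:R * c)^-1 + u / c ^+ 2 - 1)%:E.
Proof.
move=> n0 c0 Ac Au u0.
set m := (n%:R * c)%R.
have m0 : (0 < m)%R by rewrite mulr_gt0// ltr0n.
have m20 : (0 <= m ^+ 2)%R by rewrite sqr_ge0.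
have mm0 : (0 <= 2 * m)%R by rewrite mulr_ge0// ltW.
pose W w : R := (\sum_i \1_(A i) w)%R.
have pt w : (m ^+ 2 * \1_none_of w + 2 * m * W w <= (\sum_i \sum_k \1_(A i `&` A k) w) + m ^+ 2)%R.
  have -> : (\sum_i \sum_k \1_(A i `&` A k) w = W w ^+ 2)%R.
    rewrite expr2 /W mulr_suml; apply: eq_bigr => i _.
    by rewrite mulr_sumr; apply: eq_bigr => k _; rewrite indicI.
  rewrite indicE; case: (boolP (w \in none_of)) => [/set_mem Nw|_].
    rewrite (_ : W w = 0)%R ?mulr0 ?expr0n/= ?mulr1 ?addr0 ?add0r//.
    by rewrite /W big1// => i _; rewrite indicE memNset//; exact: Nw.
  rewrite mulr0 add0r -subr_ge0.
  rewrite (_ : _ - _ = (W w - m) ^+ 2)%R ?sqr_ge0//; ring.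
have mAA i k : measurable (A i `&` A k) by exact: measurableI.
have : (m ^+ 2)%:E * P none_of + (2 * m)%:E * \sum_i P (A i) <=
       \sum_i \sum_k P (A i `&` A k) + (m ^+ 2)%:E.
  have -> : (m ^+ 2)%:E * P none_of + (2 * m)%:E * \sum_i P (A i) =
      \int[P]_w ((m ^+ 2)%:E * (\1_none_of w)%:E + (2 * m)%:E * \sum_i (\1_(A i) w)%:E).
    rewrite ge0_integralD//; last 4 first.
    - by move=> w _; rewrite -EFinM lee_fin mulr_ge0// sqr_ge0.
    - by apply: emeasurable_funM => //; exact: mi.
    - move=> w _; apply: mule_ge0; last by rewrite sume_ge0.
      by rewrite lee_fin mulr_ge0// ltW.
    - by apply: emeasurable_funM => //; apply: emeasurable_sum => i; exact: mi.
    rewrite ge0_integralZl_EFin//; last exact: mi.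
    rewrite ge0_integralZl_EFin//; last first.
    - by apply: emeasurable_sum => i; exact: mi.
    - by move=> w _; rewrite sume_ge0.
    rewrite IB// ge0_integral_sum//; last by move=> i; exact: mi.
    by congr (_ + _ * _); apply: eq_bigr => i _; rewrite IB.
  have -> : \sum_i \sum_k P (A i `&` A k) + (m ^+ 2)%:E =
      \int[P]_w ((\sum_i \sum_k (\1_(A i `&` A k) w)%:E) + (m ^+ 2)%:E).
    rewrite ge0_integralD//; last 2 first.
    - by move=> w _; rewrite sume_ge0// => i _; rewrite sume_ge0.
    - by apply: emeasurable_sum => i; apply: emeasurable_sum => k; exact: mi.
    rewrite integral_cst//= probability_setT mule1; congr (_ + _).
    rewrite ge0_integral_sum//; last 2 first.
    - by move=> i; apply: emeasurable_sum => k; exact: mi.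
    - by move=> i w _; rewrite sume_ge0.
    apply: eq_bigr => i _; rewrite ge0_integral_sum//; last by move=> k; exact: mi.
    by apply: eq_bigr => k _; rewrite IB.
  apply: ge0_le_integral => //.
  - move=> w _; apply: adde_ge0; first by rewrite -EFinM lee_fin mulr_ge0// sqr_ge0.
    apply: mule_ge0; last by rewrite sume_ge0.
    by rewrite lee_fin mulr_ge0// ltW.
  - apply: emeasurable_funD; apply: emeasurable_funM => //; first exact: mi.
    by apply: emeasurable_sum => i; exact: mi.
  - apply: emeasurable_funD => //.
    by apply: emeasurable_sum => i; apply: emeasurable_sum => k; exact: mi.
  - move=> w _; rewrite sumEFin -!EFinM -EFinD.
    rewrite (_ : \sum_i \sum_k _ = (\sum_i \sum_k \1_(A i `&` A k) w)%:E).
      by rewrite -EFinD lee_fin pt.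
    by rewrite -sumEFin; apply: eq_bigr => i _; rewrite sumEFin.
have fN : P none_of \is a fin_num by rewrite fin_num_measure.
under eq_bigr do rewrite Ac.
rewrite sumEFin sumr_const card_ord -[in X in X -> _](mulr_natl c n) -/m.
(* The diagonal contributes exactly [m], the other pairs at most [n ^ 2 u]. *)
have dbl : \sum_i \sum_k P (A i `&` A k) <= (m + (n%:R) ^+ 2 * u)%:E.
  apply: (@le_trans _ _ (\sum_(i < n) (c + n%:R * u)%:E)).
    apply: lee_sum => i _; rewrite (bigD1 i)//= setIid Ac EFinD leeD2l//.
    apply: (@le_trans _ _ (\sum_(k < n | k != i) u%:E)).
      by apply: lee_sum => k ki; apply: Au; rewrite eq_sym.
    rewrite sumEFin lee_fin sumr_const -[leLHS]mulr_natl ler_wpM2r// ler_nat.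
    by rewrite (leq_trans (max_card _))// card_ord.
  by rewrite sumEFin lee_fin sumr_const card_ord -[leLHS]mulr_natl mulrDr -/m expr2 mulrA.
move=> H; have {H dbl} := le_trans H (leeD2r _ dbl).
rewrite -(fineK fN) -!EFinM -!EFinD !lee_fin; set N := fine _ => H.
have n0' : (0 < n%:R :> R)%R by rewrite ltr0n.
rewrite -(ler_pM2l (exprn_gt0 2 m0)).
have -> : (m ^+ 2 * (m^-1 + u / c ^+ 2 - 1) = m + n%:R ^+ 2 * u - m ^+ 2)%R.
  by rewrite /m; field; rewrite !gt_eqF.
by lra.
Qed.

End count.

(** * The annulus graph with a fixed number of vertices *)

Section graph_bounds.
Context {R : realType} (s : nat).

Definition cap_hi (r : R) : R := r ^+ s.+1 / (psi R s.+1 * (1 - r ^+ 2 / 2)).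
Definition cap_lo (r : R) : R := r ^+ s.+1 * (1 - r ^+ 2 / 4) ^+ s.+1 / psi R s.+1.

Lemma continuous_cap_lo : continuous cap_lo.
Proof.
move=> x; apply: cvgM; last exact: cvg_cst.
apply: cvgM; first exact: exprn_continuous.
apply: (@continuous_comp R R R (fun r => 1 - r ^+ 2 / 4) (fun y => y ^+ s.+1)); last exact: exprn_continuous.
apply: cvgB; first exact: cvg_cst.
by apply: cvgM; [exact: exprn_continuous|exact: cvg_cst].
Qed.

Lemma continuous_cap_hi0 : {for 0, continuous cap_hi}.
Proof.
apply: cvgM; first exact: exprn_continuous.
apply: cvgV.
  by rewrite expr0n/= mul0r subr0 mulr1 gt_eqF// psi_gt0.
apply: cvgM; first exact: cvg_cst.
apply: cvgB; first exact: cvg_cst.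
by apply: cvgM; [exact: exprn_continuous|exact: cvg_cst].
Qed.

Context d (Om : measurableType d) (P : probability Om R) (n : nat).
Local Notation T := (@bspace R s.+2).
Local Notation S := (@sphere R s.+1 : set T).
Variable X : 'I_n -> Om -> T.
Hypothesis hX : @iid_uniform_on_sphere R d Om P n s.+1 X.
Variables (i0 : 'I_n).

Let e0 : T := @basis_vec R s ord0.
Let Se0 : S e0.
Proof. by apply/sphereE; rewrite dotv_basis mxE !eqxx. Qed.

Let D w : R := enorm ((X i0 w : 'cV[R]_s.+2) - e0).

Let mD (B : set R) : measurable B -> measurable [set w | B (D w)].
Proof. by move=> mB; exact: (iid_preimage_measurable hX i0 (@measurable_dist R s e0 B mB)). Qed.

Let m_le r : measurable [set w | D w <= r].
Proof. exact: (@mD [set u | u <= r] (measurable_set_le r)). Qed.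

Let m_lt r : measurable [set w | D w < r].
Proof.
apply: (@mD [set u | u < r]); have -> : [set u : R | u < r] = `]-oo, r[%classic.
  by apply/seteqP; split => u /=; rewrite in_itv.
exact: measurable_itv.
Qed.

Let fineP_le (A B : set Om) : measurable A -> measurable B -> A `<=` B -> fine (P A) <= fine (P B).
Proof.
move=> mA mB AB; apply: fine_le; rewrite ?fin_num_measure//.
by apply: le_measure; rewrite ?inE.
Qed.

(** [iid_cap_bounds] asks for [r > 0]. The case [r = 0], which occurs for [b = 0], follows by
    monotonicity and the continuity of [cap_hi] at [0]. *)
Lemma cap_le_hi r : 0 <= r <= 1 -> fine (P [set w | D w <= r]) <= cap_hi r.
Proof.
move=> /andP[]; rewrite le_eqVlt => /predU1P[<- _|r0 r1]; last first.
  by have /andP[] := iid_cap_bounds hX i0 Se0 (introT andP (conj r0 r1)).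
apply: (@right_limit_le R cap_hi 0 1) => //; first exact: continuous_cap_hi0.
move=> y /andP[y0 y1].
have /andP[_ H] := iid_cap_bounds hX i0 Se0 (introT andP (conj y0 (ltW y1))).
apply: le_trans H; apply: fineP_le => //.
by move=> w /=; move/le_trans; apply; exact: ltW.
Qed.

(** The annulus contains its inner boundary, so it is a closed cap minus an open one. The bound for
    an open cap comes from the closed caps of smaller radius, by continuity. *)
Lemma cap_ge_lo r : 0 <= r <= 1 -> cap_lo r <= fine (P [set w | D w < r]).
Proof.
move=> /andP[]; rewrite le_eqVlt => /predU1P[<- _|r0 r1].
  by rewrite /cap_lo expr0n/= !mul0r fine_ge0.
apply: (@left_limit_ge R cap_lo r 0) => //; first exact: continuous_cap_lo.
move=> y /andP[y0 yr].
have /andP[H _] := iid_cap_bounds hX i0 Se0 (introT andP (conj y0 (ltW (lt_le_trans yr r1)))).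
apply: (le_trans H); apply: fineP_le => //.
by move=> w /= Dy; exact: le_lt_trans yr.
Qed.

Variables (r1 r2 : R).
Hypotheses (r10 : 0 <= r1) (r12 : r1 <= r2) (r21 : r2 <= 1).

(** Computed with one vertex [i0] and the centre [e0]; [P_farset] shows that the value serves for
    all vertices and all positions. *)
Definition edge_prob : R := fine (P [set w | r1 <= D w <= r2]).

Let m_ann : measurable [set w | r1 <= D w <= r2].
Proof.
apply: (@mD [set u | r1 <= u <= r2]); have -> : [set u : R | r1 <= u <= r2] = `[r1, r2]%classic.
  by apply/seteqP; split => u /=; rewrite in_itv.
exact: measurable_itv.
Qed.

Let split_cap : fine (P [set w | D w <= r2]) = fine (P [set w | D w < r1]) + edge_prob.
Proof.
rewrite /edge_prob -fineD ?fin_num_measure// -measureU//; last first.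
  apply/seteqP; split => // w [] /= h /andP[h' _].
  by move: h; rewrite ltNge h'.
congr (fine (P _)); apply/seteqP; split => w /=.
  by move=> Dr; have [h|h] := ltP (D w) r1; [left|right; rewrite Dr].
by case=> [h|/andP[]//]; rewrite (le_trans (ltW h)).
Qed.

Lemma edge_prob_le : edge_prob <= cap_hi r2 - cap_lo r1.
Proof.
have h1 : fine (P [set w | D w <= r2]) <= cap_hi r2.
  by apply: cap_le_hi; rewrite (le_trans r10 r12).
have h2 : cap_lo r1 <= fine (P [set w | D w < r1]).
  by apply: cap_ge_lo; rewrite r10 (le_trans r12).
by move: split_cap; lra.
Qed.

Lemma edge_prob_ge : cap_lo r2 - cap_hi r1 <= edge_prob.
Proof.
have h1 : cap_lo r2 <= fine (P [set w | D w <= r2]).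
  apply: (@le_trans _ _ (fine (P [set w | D w < r2]))).
    by apply: cap_ge_lo; rewrite (le_trans r10 r12).
  by apply: fineP_le => // w; exact: ltW.
have h2 : fine (P [set w | D w < r1]) <= cap_hi r1.
  apply: (@le_trans _ _ (fine (P [set w | D w <= r1]))).
    by apply: fineP_le => // w; exact: ltW.
  by apply: cap_le_hi; rewrite r10 (le_trans r12).
by move: split_cap; lra.
Qed.

Lemma edge_prob_ge0 : 0 <= edge_prob. Proof. exact: fine_ge0. Qed.

Lemma edge_prob_le1 : edge_prob <= 1.
Proof.
by rewrite -lee_fin /edge_prob fineK ?fin_num_measure//; exact: probability_le1.
Qed.

Let near_const j (x : T) (B : set R) : S x -> measurable B ->
  P [set w | B (enorm ((X j w : 'cV[R]_s.+2) - (x : 'cV[R]_s.+2)))] = P [set w | B (D w)].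
Proof.
move=> Sx mB; rewrite (iid_dist_const hX j Sx Se0 mB).
exact: (iid_dist_eq hX j i0 Se0 mB).
Qed.

Lemma P_farset j (x : T) : S x -> P (X j @^-1` farset r1 r2 x) = (1 - edge_prob)%:E.
Proof.
move=> Sx.
have -> : X j @^-1` farset r1 r2 x = ~` [set w | enorm ((X j w : 'cV[R]_s.+2) - (x : 'cV[R]_s.+2)) \in `[r1, r2]].
  by apply/seteqP; split => w; rewrite /farset/= in_itv/= => /negP.
have mB : measurable [set u : R | u \in `[r1, r2] ] by exact: measurable_itv.
rewrite probability_setC; last first.
  exact: (iid_preimage_measurable hX j (@measurable_dist R s x _ mB)).
rewrite (near_const j Sx mB) EFinB; congr (_ - _)%E.
by rewrite /edge_prob fineK ?fin_num_measure//; congr (P _); apply/seteqP; split => w /=; rewrite in_itv.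
Qed.

Local Notation no_iso := [set w | ~~ has_isolated (rag r1 r2 (X ^~ w))].

Lemma no_isoE : no_iso = none_of (fun i => isolated_at X r1 r2 i).
Proof.
apply/seteqP; split => w /=.
  by move=> /existsPn H i Hi; move: (H i); rewrite Hi.
by move=> H; apply/existsPn => i; apply/negP => Hi; exact: (H i).
Qed.

Lemma measurable_no_iso : measurable no_iso.
Proof.
rewrite no_isoE; apply: measurable_none_of => i.
exact: (measurable_isolated_at hX).
Qed.

Lemma P_no_iso_ge : ((1 - n%:R * (1 - edge_prob) ^+ n.-1)%:E <= P no_iso)%E.
Proof.
rewrite no_isoE; apply: none_of_ge => i; first exact: (measurable_isolated_at hX).
by apply: (P_isolated_at hX); exact: P_farset.
Qed.

Lemma P_no_iso_le : 2 * r2 <= 1 -> 2 * edge_prob <= 1 ->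
  (P no_iso <= ((n%:R * (1 - edge_prob) ^+ n.-1)^-1 +
    ((1 - 2 * edge_prob) ^+ n.-2 + (1 - edge_prob) ^+ n.-2 * cap_hi (2 * r2)) /
      (1 - edge_prob) ^+ n.-1 ^+ 2 - 1)%:E)%E.
Proof.
move=> r22 p12; rewrite no_isoE.
have p0 := edge_prob_ge0.
have q0 : 0 <= cap_hi (2 * r2).
  have := @cap_le_hi (2 * r2); rewrite mulr_ge0 ?(le_trans r10 r12)// r22 => /(_ isT).
  by apply: le_trans; exact: fine_ge0.
have p1 : 0 < 1 - edge_prob by lra.
apply: none_of_le.
- by move=> i; exact: (measurable_isolated_at hX).
- by case: (n) i0 => // -[].
- by rewrite exprn_gt0.
- by move=> i; apply: (P_isolated_at hX) => //; exact: P_farset.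
- move=> i k ik; apply: (P_two_isolated hX) => //; first exact: P_farset.
  move=> j x Sx.
  have mB := measurable_set_le (2 * r2).
  rewrite (near_const j Sx mB).
  have fN : P [set w | D w <= 2 * r2] \is a fin_num by rewrite fin_num_measure.
  rewrite -[P _](fineK fN) lee_fin.
  by apply: cap_le_hi; rewrite mulr_ge0 ?(le_trans r10 r12).
- apply: addr_ge0; first by rewrite exprn_ge0// subr_ge0.
  by rewrite mulr_ge0// exprn_ge0// ltW.
Qed.

End graph_bounds.

(** * Asymptotics *)

Section estimates.
Context {R : realType}.

Lemma expRN_le (y : R) : 0 < y -> expR (- y) <= y^-1.
Proof.
move=> y0; rewrite expRN lef_pV2 ?posrE ?expR_gt0//.
by apply: le_trans (expR_ge1Dx y); rewrite lerDr.
Qed.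

Lemma expRN_le2 (y : R) : 0 < y -> expR (- y) <= 2 / y ^+ 2.
Proof.
move=> y0; rewrite expRN -[2 / _]invf_div lef_pV2 ?posrE ?expR_gt0 ?divr_gt0 ?exprn_gt0//.
have := @expR_ge1Dxn R y 1 (ltW y0); apply: le_trans.
by rewrite lerDr.
Qed.

(** Since [1 - p <= exp (- p)], the left side is at most [exp (- e L / 2)] with [L = ln n]: half of
    [e] pays for the exponent [n - 1] in place of [n]. The crude [exp (- y) <= 1 / y] then gives the
    form [K / ln n] used in [cvg_prob1]. *)
Lemma first_moment_bound (n : nat) (p e : R) : (1 < n)%N -> 0 < e -> p <= 1 ->
  (1 + e) * (ln n%:R / n%:R) <= p -> (1 + e) / n%:R <= e / 2 ->
  n%:R * (1 - p) ^+ n.-1 <= 2 / e / ln n%:R.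
Proof.
move=> n1 e0 p1 pL ne.
have n0 : 0 < n%:R :> R by rewrite ltr0n (ltn_trans _ n1).
have L0 : 0 < ln n%:R :> R by rewrite ln_gt0// ltr1n.
set L := ln n%:R in L0 pL *.
have nL : n%:R = expR L by rewrite lnK.
have q1 : (1 - p) ^+ n.-1 <= expR (- (n.-1%:R * p)).
  rewrite -mulrN expRM_natl lerXn2r ?nnegrE ?subr_ge0 ?expR_ge0//.
  exact: expR_ge1Dx.
apply: (@le_trans _ _ (expR (- (e * L / 2)))).
  rewrite nL in q1 *.
  apply: (@le_trans _ _ (expR L * expR (- (n.-1%:R * p)))).
    by rewrite ler_pM2l ?expR_gt0.
  rewrite -expRD ler_expR.
  have n1E : n.-1%:R = n%:R - 1 :> R by rewrite -subn1 natrB// ltnW.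
  have H1 : n.-1%:R * ((1 + e) * (L / n%:R)) <= n.-1%:R * p by rewrite ler_wpM2l.
  have H2 : n.-1%:R * ((1 + e) * (L / n%:R)) = (1 + e) * L - (1 + e) / n%:R * L.
    by rewrite n1E; field; rewrite gt_eqF.
  have H3 : (1 + e) / n%:R * L <= e / 2 * L by rewrite ler_wpM2r// ltW.
  move: H1; rewrite H2 => H1; move: H1 H3; set u := _ / n%:R * L; set v := _ * p => H1 H3.
  lra.
have -> : 2 / e / L = (e * L / 2)^-1 by field; rewrite !gt_eqF.
by apply: expRN_le; rewrite divr_gt0// mulr_gt0.
Qed.

(** With [L = ln n], the quantity [n (1 - p) ^ n] is at least [exp (e L / 2)], and its inverse at
    most [8 / (e L) ^ 2]. The square of [L] is there to absorb the factor [L] of [q] in the term of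
    the close pairs. *)
Lemma second_moment_bound (n : nat) (p q e C : R) : (1 < n)%N -> 0 < e < 1 -> 0 <= C ->
  1 <= ln (n%:R : R) -> 0 <= p -> p <= (1 - e) * (ln n%:R / n%:R) -> p <= e / 2 -> p <= 4^-1 ->
  q <= C * (ln n%:R / n%:R) ->
  (n%:R * (1 - p) ^+ n.-1)^-1 +
    ((1 - 2 * p) ^+ n.-2 + (1 - p) ^+ n.-2 * q) / (1 - p) ^+ n.-1 ^+ 2 - 1 <=
  ((1 + C) * 8 / e ^+ 2 + 8) / ln n%:R.
Proof.
move=> n1 /andP[e0 e1] C0 L1 p0 pL pe p4 qC.
have n0 : 0 < n%:R :> R by rewrite ltr0n (ltn_trans _ n1).
set L := ln n%:R in L1 pL qC *.
have L0 : 0 < L := lt_le_trans ltr01 L1.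
have nL : n%:R = expR L by rewrite lnK.
have r0 : 0 < 1 - p by lra.
(* From [1 / (1 - p) = 1 + p / (1 - p) <= exp (p / (1 - p))]. *)
have ppow : expR (- (n%:R * (p / (1 - p)))) <= (1 - p) ^+ n.
  rewrite -mulrN expRM_natl lerXn2r ?nnegrE ?expR_ge0 ?(ltW r0)// expRN.
  rewrite -[leRHS]invrK lef_pV2 ?posrE ?expR_gt0 ?invr_gt0//.
  have := expR_ge1Dx (p / (1 - p)); apply: le_trans.
  by rewrite le_eqVlt; apply/orP; left; apply/eqP; field; rewrite gt_eqF.
have npow : expR (e * L / 2) <= n%:R * (1 - p) ^+ n.
  apply: le_trans (ler_wpM2l (ltW n0) ppow); rewrite {1}nL -expRD ler_expR.
  (* Uses [1 - e <= (1 - e / 2) ^ 2 <= (1 - e / 2) * (1 - p)], the last step by [p <= e / 2]. *)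
  have H : n%:R * (p / (1 - p)) <= (1 - e / 2) * L.
    rewrite mulrA ler_pdivrMr//.
    have np : n%:R * p <= (1 - e) * L.
      by move: pL; rewrite mulrA ler_pdivlMr// mulrC.
    apply: (le_trans np).
    have : (1 - e / 2) * L * (1 - e / 2) <= (1 - e / 2) * L * (1 - p).
      by rewrite ler_wpM2l// ?mulr_ge0 ?(ltW L0)//; lra.
    have : 0 <= e ^+ 2 * L by rewrite mulr_ge0 ?sqr_ge0 ?ltW.
    by rewrite expr2; lra.
  by move: H; set z := n%:R * _ => H; lra.
have N0 : 0 < n%:R * (1 - p) ^+ n by rewrite mulr_gt0 ?exprn_gt0.
have Ninv : (n%:R * (1 - p) ^+ n)^-1 <= 8 / e ^+ 2 / L ^+ 2.
  apply: (@le_trans _ _ (expR (- (e * L / 2)))).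
    by rewrite expRN lef_pV2 ?posrE ?expR_gt0.
  apply: le_trans (expRN_le2 _) _; first by rewrite divr_gt0// mulr_gt0.
  by rewrite le_eqVlt; apply/orP; left; apply/eqP; field; rewrite !gt_eqF.
have T1 : (n%:R * (1 - p) ^+ n.-1)^-1 <= (n%:R * (1 - p) ^+ n)^-1.
  rewrite lef_pV2 ?posrE ?mulr_gt0 ?exprn_gt0// ler_pM2l//.
  rewrite -[in leLHS](prednK (ltnW n1)) exprS ger_pMl ?exprn_gt0//; lra.
have pw0 k : 0 < (1 - p) ^+ k by rewrite exprn_gt0.
have En : (1 - p) ^+ n.-1 ^+ 2 = (1 - p) ^+ n.-2 * (1 - p) ^+ n.
  by rewrite -exprM -exprD; congr (_ ^+ _); case: (n) n1 => [|[|m]]//= _; rewrite muln2 -addnn addSnnS.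
have En2 : (1 - p) ^+ n.-1 ^+ 2 = (1 - p) ^+ 2 ^+ n.-2 * (1 - p) ^+ 2.
  by rewrite -exprSr -!exprM; congr (_ ^+ _); case: (n) n1 => [|[|m]]//= _; rewrite mulnC.
(* [1 - 2 p <= (1 - p) ^ 2] cancels [n - 2] powers; the remaining [(1 - p) ^ - 2] is at most
   [1 + 4 p] for [p <= 1 / 4]. *)
have T2 : (1 - 2 * p) ^+ n.-2 / (1 - p) ^+ n.-1 ^+ 2 <= 1 + 4 * p.
  rewrite ler_pdivrMr ?exprn_gt0// En2 mulrCA.
  apply: (@le_trans _ _ ((1 - p) ^+ 2 ^+ n.-2 * 1)).
    rewrite mulr1 lerXn2r ?nnegrE ?exprn_ge0 ?(ltW r0)//; first lra.
    have : 0 <= p * p by rewrite mulr_ge0.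
    by rewrite expr2; lra.
  rewrite ler_wpM2l ?exprn_ge0 ?(ltW r0)// expr2.
  have : 0 <= p * p by rewrite mulr_ge0.
  by nra.
have T3 : (1 - p) ^+ n.-2 * q / (1 - p) ^+ n.-1 ^+ 2 <= C * L * (8 / e ^+ 2 / L ^+ 2).
  rewrite En -mulf_div divff ?gt_eqF// mul1r.
  apply: (@le_trans _ _ (C * L * (n%:R * (1 - p) ^+ n)^-1)); last first.
    by rewrite ler_wpM2l// mulr_ge0// ltW.
  rewrite invfM mulrA ler_pM2r ?invr_gt0//.
  by rewrite -mulrA.
(* Since [n = exp L >= L ^ 2 / 2]; the term [4 * p] above then costs at most [8 / L]. *)
have x0 : L / n%:R <= 2 / L.
  rewrite nL -expRN; apply: (@le_trans _ _ (L * (2 / L ^+ 2))).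
    by rewrite ler_pM2l// expRN_le2.
  by rewrite le_eqVlt; apply/orP; left; apply/eqP; field; rewrite gt_eqF.
have p2 : p <= 2 / L.
  apply: (le_trans pL); apply: le_trans x0.
  by rewrite ger_pMl ?divr_gt0//; lra.
have E8 : 8 / e ^+ 2 / L ^+ 2 <= 8 / e ^+ 2 / L.
  rewrite ler_pM2l ?divr_gt0 ?exprn_gt0// lef_pV2 ?posrE ?exprn_gt0// expr2.
  by rewrite ler_peMl// ltW.
have E9 : C * L * (8 / e ^+ 2 / L ^+ 2) = C * (8 / e ^+ 2 / L).
  by field; rewrite !gt_eqF.
have -> : ((1 + C) * 8 / e ^+ 2 + 8) / L = 8 / e ^+ 2 / L + C * (8 / e ^+ 2 / L) + 4 * (2 / L).
  by field; rewrite !gt_eqF.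
rewrite mulrDl.
move: T1 T2 T3 Ninv E8 p2; rewrite E9.
set A1 := (n%:R * _ ^+ n.-1)^-1; set A2 := (n%:R * _ ^+ n)^-1; set B1 := (1 - 2 * p) ^+ _ / _.
set B2 := (_ * q) / _; set D1 := 8 / _ / _ ^+ 2; set D2 := 8 / _ / L; set D3 := C * _; set D4 := 2 / L.
by move=> *; lra.
Qed.

End estimates.

Section limits.
Context {R : realType}.

Lemma near_ln_ge (M : R) : \forall n \near \oo, M <= ln (n%:R : R).
Proof.
near=> n.
have Mn : expR M <= n%:R by near: n; exact: nbhs_infty_ger.
rewrite -[M]expRK ler_ln// posrE ?expR_gt0//.
by apply: lt_le_trans Mn; exact: expR_gt0.
Unshelve. all: by end_near. Qed.

Lemma cvg_div_ln (K : R) : K / ln n%:R @[n --> \oo] --> (0 : R).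
Proof.
rewrite -(mulr0 K); apply: cvgM; first exact: cvg_cst.
apply/gtr0_cvgV0.
  by apply: filterS (near_ln_ge 1) => n; exact: lt_le_trans.
by apply/cvgryPge => M; exact: near_ln_ge.
Qed.

Lemma cvg_ln_div : ln n%:R / n%:R @[n --> \oo] --> (0 : R).
Proof.
apply: (@squeeze_cvgr _ _ _ _ (cst 0) (fun n => 2 / ln n%:R)); last 2 first.
- exact: cvg_cst.
- exact: cvg_div_ln.
near=> n.
have L1 : 1 <= ln (n%:R : R) by near: n; exact: near_ln_ge.
have L0 := lt_le_trans ltr01 L1.
have n0 : 0 < n%:R :> R by rewrite ltr0n; near: n; exact: nbhs_infty_gt.
rewrite /= divr_ge0 ?(ltW L0) ?(ltW n0)//=.
rewrite -[X in _ / X <= _](lnK n0) -expRN.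
apply: (@le_trans _ _ (ln n%:R * (2 / ln n%:R ^+ 2))).
  by rewrite ler_pM2l// expRN_le2.
by rewrite le_eqVlt; apply/orP; left; apply/eqP; field; rewrite gt_eqF.
Unshelve. all: by end_near. Qed.

Definition scale (t : nat) (n : nat) : R := (ln n%:R / n%:R) `^ (t%:R^-1).

Lemma scale_ge0 t n : 0 <= scale t n. Proof. exact: powR_ge0. Qed.

Lemma scaleX t n : 0 <= ln (n%:R : R) -> scale t.+1 n ^+ t.+1 = ln n%:R / n%:R.
Proof.
move=> L0; rewrite /scale -powR_mulrn ?powR_ge0// -powRrM mulVf ?pnatr_eq0//.
by rewrite powRr1// divr_ge0.
Qed.

Lemma cvg_scale t : scale t.+1 n @[n --> \oo] --> (0 : R).
Proof.
apply/cvgr0Pnorm_lt => e e0; near=> n.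
have L1 : 1 <= ln (n%:R : R) by near: n; exact: near_ln_ge.
have L0 := lt_le_trans ltr01 L1.
rewrite ger0_norm ?scale_ge0// -(ltr_pXn2r (n:=t.+1)) ?nnegrE ?scale_ge0 ?(ltW e0)//.
rewrite scaleX ?(ltW L0)//; near: n.
by apply: (cvgr_lt 0 cvg_ln_div); rewrite exprn_gt0.
Unshelve. all: by end_near. Qed.

Lemma cvg_prob1 (u : nat -> \bar R) (K : R) :
  (\forall n \near \oo, ((1 - K / ln n%:R)%:E <= u n <= 1)%E) ->
  u n @[n --> \oo] --> 1%E.
Proof.
move=> H; apply: (squeeze_cvge H); last exact: cvg_cst.
apply: cvg_EFin; first exact: nearW.
rewrite -[X in _ --> X](subr0 1); apply: cvgB; first exact: cvg_cst.
exact: cvg_div_ln.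
Qed.

Section radii.
Variable s : nat.

(** The bound [cap_hi (c r)] divided by [r ^ t]. At [r = scale t n] it measures caps in units of
    [ln n / n], and tends to [c ^ t / psi t]; [cap_lo_coef] plays the same part for [cap_lo]. *)
Definition cap_hi_coef (c r : R) : R := c ^+ s.+1 / (psi R s.+1 * (1 - (c * r) ^+ 2 / 2)).
Definition cap_lo_coef (c r : R) : R := c ^+ s.+1 * (1 - (c * r) ^+ 2 / 4) ^+ s.+1 / psi R s.+1.

Lemma cap_hi_scale c r : cap_hi s (c * r) = cap_hi_coef c r * r ^+ s.+1.
Proof. by rewrite /cap_hi /cap_hi_coef exprMn mulrAC. Qed.

Lemma cap_lo_scale c r : cap_lo s (c * r) = cap_lo_coef c r * r ^+ s.+1.
Proof.
by rewrite /cap_lo /cap_lo_coef [(c * r) ^+ s.+1]exprMn -!mulrA; congr (_ * _); rewrite mulrC -!mulrA.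
Qed.

Lemma cvg_sq_scale c k : 1 - (c * scale s.+1 n) ^+ 2 / k @[n --> \oo] --> (1 : R).
Proof.
have h : c * scale s.+1 n @[n --> \oo] --> c * 0.
  by apply: cvgM; [exact: cvg_cst|exact: cvg_scale].
have h2 := cvg_comp _ _ h (@exprn_continuous R 2 (c * 0)).
have := cvgB (cvg_cst (1 : R)) (cvgM h2 (cvg_cst k^-1)).
by rewrite mulr0 expr0n/= mul0r subr0; exact.
Qed.

Lemma cvg_cap_hi_coef c : cap_hi_coef c (scale s.+1 n) @[n --> \oo] --> c ^+ s.+1 / psi R s.+1.
Proof.
rewrite /cap_hi_coef -[psi R s.+1 in X in _ --> X]mulr1.
apply: cvgM; first exact: cvg_cst.
apply: cvgV; first by rewrite mulr1 gt_eqF// psi_gt0.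
by apply: cvgM; [exact: cvg_cst|exact: cvg_sq_scale].
Qed.

Lemma cvg_cap_lo_coef c : cap_lo_coef c (scale s.+1 n) @[n --> \oo] --> c ^+ s.+1 / psi R s.+1.
Proof.
have h := cvg_comp _ _ (@cvg_sq_scale c 4) (@exprn_continuous R s.+1 1).
have := cvgM (cvgM (cvg_cst (c ^+ s.+1)) h) (cvg_cst (psi R s.+1)^-1).
by rewrite expr1n mulr1; exact.
Qed.

End radii.

End limits.

Theorem theorem2 (R : realType) (t : nat) (ht : (1 <= t)%N)
    (a b : R) (hb : 0 <= b) (hab : b <= a)
    (d : nat -> measure_display) (Om : forall n, measurableType (d n))
    (P : forall n, probability (Om n) R)
    (X : forall n, 'I_n -> Om n -> 'cV[R]_t.+1)
    (hX : forall n, iid_uniform_on_sphere (P n) (X n)) :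
  (a ^+ t - b ^+ t < psi R t ->
     P n [set w | has_isolated
                    (rag (scaled_radius t b n) (scaled_radius t a n) (X n ^~ w))]
       @[n --> \oo] --> 1%E)
  /\
  (psi R t < a ^+ t - b ^+ t ->
     P n [set w | ~~ has_isolated
                    (rag (scaled_radius t b n) (scaled_radius t a n) (X n ^~ w))]
       @[n --> \oo] --> 1%E).
Proof.
case: t ht X hX => // s _ X hX.
have psi0 := @psi_gt0 R s.
have a0 : 0 <= a := le_trans hb hab.
pose k := (a ^+ s.+1 - b ^+ s.+1) / psi R s.+1.
have r10 n : 0 <= scaled_radius s.+1 b n by rewrite mulr_ge0// powR_ge0.
have r12 n : scaled_radius s.+1 b n <= scaled_radius s.+1 a n.
  by rewrite ler_wpM2r// powR_ge0.
have near_r (e : R) : 0 < e -> \forall n \near \oo, scaled_radius s.+1 a n <= e.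
  move=> e0; have c : scaled_radius s.+1 a n @[n --> \oo] --> (0 : R).
    by rewrite -(mulr0 a); apply: cvgM; [exact: cvg_cst|exact: cvg_scale].
  by apply: filterS (cvgr_lt _ c _ e0) => n; exact: ltW.
split=> hk.
- have k1 : k < 1 by rewrite /k ltr_pdivrMr// mul1r.
  have k0 : 0 <= k by rewrite divr_ge0 ?(ltW psi0)// subr_ge0 lerXn2r ?nnegrE.
  (* [1 - e] lies midway between [k] and [1], so [n p / ln n], whose limit is [k], is eventually
     below it. *)
  pose e := (1 - k) / 2; have e01 : 0 < e < 1 by rewrite /e; apply/andP; split; lra.
  have /andP[e0 e1] := e01.
  (* The limit of [cap_hi_coef] for the radius [2 * r_2], plus [1] to make room for an inequality
     valid for large [n]. *)
  pose C := (2 * a) ^+ s.+1 / psi R s.+1 + 1.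
  have C0 : 0 <= C by rewrite addr_ge0// divr_ge0 ?(ltW psi0)// exprn_ge0// mulr_ge0.
  apply: (@cvg_prob1 _ _ ((1 + C) * 8 / e ^+ 2 + 8)); near=> n.
  have n1 : (1 < n)%N by near: n; exact: nbhs_infty_gt.
  have L1 : 1 <= ln (n%:R : R) by near: n; exact: near_ln_ge.
  have L0 := lt_le_trans ltr01 L1.
  have n0 : 0 < n%:R :> R by rewrite ltr0n (ltn_trans _ n1).
  have i0 : 'I_n := Ordinal (ltn_trans (ltnSn 0) n1).
  have x0 : 0 < ln n%:R / n%:R :> R by rewrite divr_gt0.
  have xe : ln n%:R / n%:R < e / 2.
    by near: n; apply: (cvgr_lt _ cvg_ln_div); rewrite divr_gt0.
  have x4 : ln n%:R / n%:R < 4^-1 :> R.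
    by near: n; apply: (cvgr_lt _ cvg_ln_div); rewrite invr_gt0.
  have r2h : scaled_radius s.+1 a n <= 2^-1 by near: n; apply: near_r; rewrite invr_gt0.
  have r21 : scaled_radius s.+1 a n <= 1 by apply: le_trans r2h _; rewrite invf_le1// ler1n.
  have gk : cap_hi_coef s a (scale s.+1 n) - cap_lo_coef s b (scale s.+1 n) < 1 - e.
    near: n; apply: (cvgr_lt k); last by rewrite /e; lra.
    by rewrite /k mulrBl; apply: cvgB; [exact: cvg_cap_hi_coef|exact: cvg_cap_lo_coef].
  have gC : cap_hi_coef s (2 * a) (scale s.+1 n) < C.
    by near: n; apply: (cvgr_lt _ (@cvg_cap_hi_coef R s (2 * a))); rewrite ltrDl.
  have p0 := edge_prob_ge0 (P n) (X n) i0 (scaled_radius s.+1 b n) (scaled_radius s.+1 a n).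
  have pU := edge_prob_le (hX n) i0 (r10 n) (r12 n) r21.
  have sX := scaleX s (ltW L0).
  have pL : edge_prob (P n) (X n) i0 (scaled_radius s.+1 b n) (scaled_radius s.+1 a n) <=
      (1 - e) * (ln n%:R / n%:R).
    apply: (le_trans pU); rewrite cap_hi_scale cap_lo_scale -mulrBl sX.
    by rewrite ler_wpM2r// ltW.
  set p := edge_prob _ _ _ _ _ in p0 pU pL.
  have px : p <= ln n%:R / n%:R.
    by apply: (le_trans pL); rewrite ger_pMl// gerBl ltW.
  have pe : p <= e / 2 by apply: le_trans px _; exact: ltW.
  have p4 : p <= 4^-1 by apply: le_trans px _; exact: ltW.
  have qC : cap_hi s (2 * scaled_radius s.+1 a n) <= C * (ln n%:R / n%:R).
    have -> : 2 * scaled_radius s.+1 a n = 2 * a * scale s.+1 n by rewrite -mulrA.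
    by rewrite cap_hi_scale sX ler_wpM2r// ltW.
  have H : (P n [set w | ~~ has_isolated (rag (scaled_radius s.+1 b n) (scaled_radius s.+1 a n) (X n ^~ w))]
      <= (((1 + C) * 8 / e ^+ 2 + 8) / ln n%:R)%:E)%E.
    have r2' : 2 * scaled_radius s.+1 a n <= 1 by rewrite mulrC -ler_pdivlMr// mul1r.
    have p2 : 2 * p <= 1 by rewrite -ler_pdivlMl// (le_trans p4)// mulr1 lef_pV2 ?posrE// ler_nat.
    have H := P_no_iso_le (hX n) (r10 n) (r12 n) r2' p2.
    apply: (le_trans H).
    by rewrite lee_fin; apply: second_moment_bound.
  have mI := measurable_no_iso (hX n) (scaled_radius s.+1 b n) (scaled_radius s.+1 a n).
  rewrite (_ : [set w | has_isolated _] =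
    ~` [set w | ~~ has_isolated (rag (scaled_radius s.+1 b n) (scaled_radius s.+1 a n) (X n ^~ w))]); last first.
    by apply/seteqP; split => w /= => [->//|/negP]; rewrite negbK.
  rewrite probability_le1 ?andbT; last exact: measurableC.
  by rewrite probability_setC// EFinB leeB.
- have k1 : 1 < k by rewrite /k ltr_pdivlMr// mul1r.
  (* Here [1 + e] is the midpoint of [1] and [k], and a lower bound of [n p / ln n] for large
     [n]. *)
  pose e := (k - 1) / 2; have e0 : 0 < e by rewrite /e; lra.
  apply: (@cvg_prob1 _ _ (2 / e)); near=> n.
  have n1 : (1 < n)%N by near: n; exact: nbhs_infty_gt.
  have L1 : 1 <= ln (n%:R : R) by near: n; exact: near_ln_ge.
  have L0 := lt_le_trans ltr01 L1.
  have n0 : 0 < n%:R :> R by rewrite ltr0n (ltn_trans _ n1).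
  have i0 : 'I_n := Ordinal (ltn_trans (ltnSn 0) n1).
  have x0 : 0 < ln n%:R / n%:R :> R by rewrite divr_gt0.
  have r21 : scaled_radius s.+1 a n <= 1 by near: n; exact: near_r.
  have ne : (1 + e) / n%:R <= e / 2.
    have e20 : 0 < e / 2 by exact: divr_gt0.
    rewrite ler_pdivrMr// -ler_pdivrMl//.
    by near: n; exact: nbhs_infty_ger.
  have gk : 1 + e < cap_lo_coef s a (scale s.+1 n) - cap_hi_coef s b (scale s.+1 n).
    near: n; apply: (cvgr_gt k); last by rewrite /e; lra.
    by rewrite /k mulrBl; apply: cvgB; [exact: cvg_cap_lo_coef|exact: cvg_cap_hi_coef].
  have pU := edge_prob_ge (hX n) i0 (r10 n) (r12 n) r21.
  have sX := scaleX s (ltW L0).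
  have pL : (1 + e) * (ln n%:R / n%:R) <=
     edge_prob (P n) (X n) i0 (scaled_radius s.+1 b n) (scaled_radius s.+1 a n).
    apply: le_trans pU; rewrite cap_hi_scale cap_lo_scale -mulrBl sX.
    by rewrite ler_wpM2r// ltW.
  have mI := measurable_no_iso (hX n) (scaled_radius s.+1 b n) (scaled_radius s.+1 a n).
  apply/andP; split; last exact: probability_le1.
  apply: le_trans (P_no_iso_ge (hX n) i0 _ _).
  rewrite lee_fin lerD2l lerN2; apply: first_moment_bound => //.
  exact: (edge_prob_le1 (hX n)).
Unshelve. all: by end_near. Qed.
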